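(* For every monomial $\mathbf z\in V(A)$, one has $$\Delta_{\mathrm{PLOT}}(\mathbf z)=\sum_{\mathfrak c\in\mathrm{LAdm}(\mathbf z)}P^{\mathfrak c}(\mathbf z)\otimes R^{\mathfrak c}(\mathbf z).$$
   Context: $\mathbf{k}$ is a field of characteristic zero and $A$ is a finite set. Word side. $\mathcal Z_A=\{z_i^a \mid a\in A,\ i\in\mathbb Z_{\ge -1}\}$, $\overline{\mathrm{PN}}(A)=\mathbf{k}\langle \mathcal Z_A\rangle$ is the free unital associative algebra, $\mathrm{wt}(z_i^a)=i$ (additive on words), $d(z_i^a)=a$. $\overline{\mathrm{PN}}(A)_{\le 0}$ is the span of monomials of weight $\le0$, $[x,y]_{\cdot}=xy-yx$, and $\partial(z_i^a)=z_{i+1}^a$ on letters. $V(A)$ is the span of the monomials $z_{i_1}^{a_1}\cdots z_{i_p}^{a_p}$ with $\sum_{r=1}^p i_r=-1$ and $\sum_{r=1}^q i_r\ge 0$ for $1\le q<p$. $\mathfrak g(A)$ is the Lie subalgebra of $\overline{\mathrm{PN}}(A)_{\le 0}$ generated by $V(A)$. For monomials $\mathbf x$, $\mathbf y=y_1\cdots y_q$ of weight $\le 0$, $\mathbf x\blacktriangleright_w\mathbf y=\sum_{j=1}^q y_1\cdots y_{j-1}\,\partial^{-\mathrm{wt}(\mathbf x)}(y_j)\,\mathbf x\,y_{j+1}\cdots y_q$, extended bilinearly. This makes $\mathfrak g(A)$ a post-Lie algebra: $x\blacktriangleright_w[y,z]_{\cdot}=[x\blacktriangleright_w y,z]_{\cdot}+[y,x\blacktriangleright_w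 z]_{\cdot}$ and $[x,y]_{\cdot}\blacktriangleright_w z=a(x,y,z)-a(y,x,z)$ with $a(x,y,z)=x\blacktriangleright_w(y\blacktriangleright_w z)-(x\blacktriangleright_w y)\blacktriangleright_w z$. The Hopf algebra $\mathcal H_{\mathrm{PLOT}}^A$. The product $\blacktriangleright=\blacktriangleright_w$ extends uniquely to $U(\mathfrak g(A))$ by $\mathbf 1\blacktriangleright X=X$, $(xX)\blacktriangleright y=x\blacktriangleright(X\blacktriangleright y)-(x\blacktriangleright X)\blacktriangleright y$, $X\blacktriangleright(YZ)=\sum_{(X)}(X_{(1)}\blacktriangleright Y)(X_{(2)}\blacktriangleright Z)$ ($x,y\in\mathfrak g(A)$), where $\Delta_{\sqcup\!\sqcup}(X)=\sum X_{(1)}\otimes X_{(2)}$ is the coproduct of $U(\mathfrak g(A))$ for which elements of $\mathfrak g(A)$ are primitive. With $X\star Y=\sum_{(X)}X_{(1)}(X_{(2)}\blacktriangleright Y)$, $(U(\mathfrak g(A)),\star,\Delta_{\sqcup\!\sqcup},\mathbf 1,\varepsilon)$ is a Hopf algebra graded by word length with finite-dimensional components, and $\mathcal H_{\mathrm{PLOT}}^A$ is its graded dual; $\Delta_{\mathrm{PLOT}}$ is its coproduct, i.e. $\langle\Delta_{\mathrm{PLOT}}(w),X\otimes Y\rangle=\langle w,X\star Y\rangle$. The Lie algebra $\mathfrak g(A)$ is free on the monomials of $V(A)$, so $U(\mathfrak g(A))$ is the free associative algebra on these monomials, with basis $\mathcal W(A)=\{\mathbf w_1\cdots\mathbf w_r\mid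 r\ge0,\ \mathbf w_i\in V(A)\text{ monomials}\}$; $\mathcal H_{\mathrm{PLOT}}^A$ is identified with $\mathbf{k}\mathcal W(A)$ through the dual basis, its product then being the shuffle product $\sqcup\!\sqcup$ of sequences $(\mathbf w_1,\dots,\mathbf w_r)$ (each monomial $\mathbf w_i\in V(A)$ is treated as a single letter). Children. Let $\mathbf z=x_1\cdots x_p\in V(A)$ be a monomial; its letters are regarded as distinct occurrences. For $1\le j\le p$ let $b(x_j)=\min\{k\ge j\mid\sum_{m=j}^k\mathrm{wt}(x_m)=-1\}$, $B(x_j)=x_jx_{j+1}\cdots x_{b(x_j)}$ and $B^\circ(x_j)=x_{j+1}\cdots x_{b(x_j)}$. Let $r=\mathrm{wt}(x_j)+1$. If $r=0$, $\mathrm{Ch}(x_j)=\emptyset$; if $r\ge1$, put $c_{j,1}=j+1$, $c_{j,s+1}=b(x_{c_{j,s}})+1$ for $1\le s\le r-1$, and $\mathrm{Ch}(x_j)=\{x_{c_{j,1}}<\dots<x_{c_{j,r}}\}$ (ordered). Every $x_k$ with $k\ge2$ lies in exactly one $\mathrm{Ch}(x_j)$; this $x_j$ is the parent of $x_k$. Left-admissible cuts. A non-total left-admissible cut of $\mathbf z$ is a subset $\mathfrak c\subseteq\{x_2,\dots,x_p\}$ (possibly empty) such that (1) for every $j$, $\mathfrak c\cap\mathrm{Ch}(x_j)$ is an initial segment $\{x_{c_{j,1}},\dots,x_{c_{j,m_j}}\}$ ($0\le m_j\le r$) of $\mathrm{Ch}(x_j)$; (2) for distinct $x_j,x_k\in\mathfrak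 c$, $x_j$ does not occur in $B^\circ(x_k)$ and $x_k$ does not occur in $B^\circ(x_j)$. $\mathrm{LAdm}(\mathbf z)$ is the set of these cuts together with the total cut $\{x_1,\dots,x_p\}$. Pruning and trunk. For $\mathfrak c=\{x_{j_1}<\dots<x_{j_r}\}$ neither empty nor total, the pruned blocks are $B(x_{j_1}),\dots,B(x_{j_r})$ (pairwise disjoint elements of $V(A)$). $P^{\mathfrak c}(\mathbf z)$ is obtained by concatenating, in increasing order of indices, the blocks whose first letters have the same parent (giving an element of $\mathcal W(A)$ for each parent), and then taking the shuffle product $\sqcup\!\sqcup$ of these elements over the different parents. $R^{\mathfrak c}(\mathbf z)$ is the word obtained from $x_1\cdots x_p$ by deleting all letters in the pruned blocks and replacing each remaining letter $x_j$ by $z^{d(x_j)}_{\mathrm{wt}(x_j)-|\mathfrak c\cap\mathrm{Ch}(x_j)|}$, keeping the order. For the empty cut, $P^{\emptyset}(\mathbf z)=\mathbf 1$, $R^{\emptyset}(\mathbf z)=\mathbf z$; for the total cut, $P^{\mathfrak c}(\mathbf z)=\mathbf z$, $R^{\mathfrak c}(\mathbf z)=\mathbf 1$. *)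

(* Defs.v *)
(* MathComp, with the monoid algebras {malg k[M]} of multinomials. *)
From HB Require Import structures.
From mathcomp Require Import all_boot all_order all_algebra.
From mathcomp Require Import finmap monalg.

Set Implicit Arguments.
Unset Strict Implicit.
Unset Printing Implicit Defensive.

Import GRing.Theory Num.Theory.
Local Open Scope ring_scope.

Section FreeModules.

Context (k : fieldType).

Definition lin_ext (T : choiceType) (M : lmodType k) (f : T -> M)
  (x : {malg k[T]}) : M := \sum_(t <- msupp x) x@_t *: f t.

Definition lin_ext2 (S T : choiceType) (M : lmodType k) (f : S -> T -> M)
  (x : {malg k[S]}) (y : {malg k[T]}) : M :=
  lin_ext (fun s => lin_ext (f s) y) x.

(* k[S] (x) k[T] is identified with k[S * T]. *)
Definition tensor (S T : choiceType) :
  {malg k[S]} -> {malg k[T]} -> {malg k[(S * T)%type]} :=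
  lin_ext2 (fun s t => << (s, t) >>).

Definition pairing (T : choiceType) (x y : {malg k[T]}) : k :=
  \sum_(t <- msupp x) x@_t * y@_t.

Inductive lie_generated (R : lalgType k) (S : R -> Prop) : R -> Prop :=
| LieGen x : S x -> lie_generated S x
| Lie0 : lie_generated S 0
| LieLin a x y :
    lie_generated S x -> lie_generated S y -> lie_generated S (a *: x + y)
| LieBracket x y :
    lie_generated S x -> lie_generated S y -> lie_generated S (x * y - y * x).

End FreeModules.

(* The componentwise product on pairs of monomials makes {malg k[M * N]} the
   tensor product algebra of {malg k[M]} and {malg k[N]}. *)
Section PairMonomial.

Context (M N : monomType).
Implicit Types p q : (M * N)%type.

Definition pair_one : (M * N)%type := (mone, mone).
Definition pair_mul p q : (M * N)%type := (mmul p.1 q.1, mmul p.2 q.2).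

Lemma pair_mulA : associative pair_mul.
Proof. by move=> p q r; rewrite /pair_mul !mulmA. Qed.

Lemma pair_mul1 : left_id pair_one pair_mul.
Proof. by case=> p q; rewrite /pair_mul !mul1m. Qed.

Lemma pair_mulr1 : right_id pair_one pair_mul.
Proof. by case=> p q; rewrite /pair_mul !mulm1. Qed.

Lemma pair_unit p q : pair_mul p q = pair_one -> p = pair_one /\ q = pair_one.
Proof.
by case: p q => [p p'] [q q'] [/unitm [/= -> ->] /unitm [/= -> ->]].
Qed.

HB.instance Definition _ := Choice_isMonomialDef.Build (M * N)%type
  pair_mulA pair_mul1 pair_mulr1 pair_unit.

End PairMonomial.

(* (a, n) stands for z_{n-1}^a. *)
Notation letter A := (A * nat)%type.

Section Words.

Context (A : finType).

Definition lwt (z : letter A) : int := z.2%:Z - 1.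
Definition wt (w : seq (letter A)) : int := \sum_(z <- w) lwt z.

Definition raise (n : nat) (z : letter A) : letter A := (z.1, (z.2 + n)%N).
(* Only used with n <= wt z + 1, where the subtraction is not truncated. *)
Definition lower (n : nat) (z : letter A) : letter A := (z.1, (z.2 - n)%N).

Definition in_V (w : seq (letter A)) : bool :=
  (wt w == -1) && all (fun q => 0 <= wt (take q w)) (iota 1 (size w).-1).

(* The monomials of V(A). *)
Record vmon : predArgType :=
  VMon { vword :> seq (letter A); _ : in_V vword }.
HB.instance Definition _ := [isSub for vword].
HB.instance Definition _ := [Choice of vmon by <:].

End Words.

(* W(A): the free monoid on the monomials of V(A). *)
Notation Wmon A := {fmonom (vmon A)}.

Definition concat (A : finType) (w : Wmon A) : seq (letter A) :=
  flatten (map (@vword A) w).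

Notation PN k A := {malg k[{fmonom (letter A)}]}.

(* U(g(A)), as the free associative algebra on the monomials of V(A); the
   elements of g(A) are those of the Lie subalgebra generated by V(A). *)
Notation Ug k A := {malg k[Wmon A]}.
Notation UgUg k A := {malg k[(Wmon A * Wmon A)%type]}.

(* The graded dual of U(g(A)), as k W(A) with the dual basis. Its product is
   the shuffle product below, not the ring product of Ug. *)
Notation PLOT k A := {malg k[Wmon A]}.
Notation PLOT2 k A := {malg k[(Wmon A * Wmon A)%type]}.

Section PostLie.

Context (k : fieldType) (A : finType).

Definition vgen (v : vmon A) : Ug k A := << FMonom [:: v] : Wmon A >>.

Definition in_g : Ug k A -> Prop :=
  lie_generated (fun x => exists v : vmon A, x = vgen v).

(* The algebra morphism U(g(A)) -> PN(A) extending the inclusion of g(A). *)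
Definition to_PN : Ug k A -> PN k A :=
  lin_ext (fun w => << FMonom (concat w) >> : PN k A).

(* The exponent -wt(x) is written as an absolute value: the product is only
   meant for words of weight <= 0. *)
Definition wgraft_word (x y : seq (letter A)) : PN k A :=
  \sum_(j < size y)
    << FMonom (take j y ++ raise `|wt x|%N (tnth (in_tuple y) j) :: x
               ++ drop j.+1 y) >>.

Definition wgraft : PN k A -> PN k A -> PN k A :=
  lin_ext2 (fun x y : {fmonom letter A} => wgraft_word x y).

(* The algebra morphism U -> U (x) U for which the elements of V(A), hence
   those of g(A), are primitive. *)
Definition unshuffle : Ug k A -> UgUg k A :=
  lin_ext (fun w : Wmon A =>
    \prod_(v <- (w : seq (vmon A)))
      (tensor (vgen v) (1 : Ug k A) + tensor (1 : Ug k A) (vgen v)) : UgUg k A).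

(* \sum_(X) F X_(1) X_(2), for a bilinear F. *)
Definition sweedler (M : lmodType k) (F : Ug k A -> Ug k A -> M)
  (X : Ug k A) : M :=
  lin_ext (fun p : (Wmon A * Wmon A)%type => F << p.1 >> << p.2 >>)
    (unshuffle X).

Record postlie_extension (tri : Ug k A -> Ug k A -> Ug k A) : Prop :=
  PostlieExtension {
  tri_linearl : forall a X X' Y, tri (a *: X + X') Y = a *: tri X Y + tri X' Y;
  tri_linearr : forall a X Y Y', tri X (a *: Y + Y') = a *: tri X Y + tri X Y';
  tri_g : forall x y, in_g x -> in_g y ->
    in_g (tri x y) /\ to_PN (tri x y) = wgraft (to_PN x) (to_PN y);
  tri_1 : forall X, tri 1 X = X;
  tri_Ml : forall x X y, in_g x -> in_g y ->
    tri (x * X) y = tri x (tri X y) - tri (tri x X) y;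
  tri_Mr : forall X Y Z,
    tri X (Y * Z) = sweedler (fun X1 X2 => tri X1 Y * tri X2 Z) X }.

Definition star (tri : Ug k A -> Ug k A -> Ug k A) (X Y : Ug k A) : Ug k A :=
  sweedler (fun X1 X2 => X1 * tri X2 Y) X.

End PostLie.

Section PLOT.

Context (k : fieldType) (A : finType).

Definition word (s : seq (vmon A)) : PLOT k A := << FMonom s : Wmon A >>.

Definition is_PLOT_coproduct (tri : Ug k A -> Ug k A -> Ug k A)
  (Delta : PLOT k A -> PLOT2 k A) : Prop :=
  forall (w : PLOT k A) (X Y : Ug k A),
    pairing (Delta w) (tensor X Y) = pairing w (star tri X Y).

Fixpoint shuffles (T : Type) (u v : seq T) {struct u} : seq (seq T) :=
  if u is a :: u' then
    (fix shuffles_u v := if v is b :: v' then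
       map (cons a) (shuffles u' v) ++ map (cons b) (shuffles_u v')
     else [:: u]) v
  else [:: v].

Definition shuffle : PLOT k A -> PLOT k A -> PLOT k A :=
  lin_ext2 (fun u v : Wmon A =>
    \sum_(s <- shuffles (u : seq (vmon A)) v) word s : PLOT k A).

End PLOT.

(* The letters of z = x_1 ... x_p are numbered from 0 here: position j is
   x_{j+1}. *)
Section Cuts.

Context (A : finType) (z : vmon A).
Let p := size z.
Let x (j : 'I_p) : letter A := tnth (in_tuple z) j.

Definition block_end (j : nat) : nat :=
  (j + find (fun n => wt (take n.+1 (drop j z)) == (-1)%R) (iota 0 (p - j)))%N.

Definition block_word (j : nat) : seq (letter A) :=
  drop j (take (block_end j).+1 z).

Definition in_block_tail (i j : nat) : bool := (j < i <= block_end j)%N.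
Definition in_block (i j : nat) : bool := (j <= i <= block_end j)%N.

(* wt(x_j) + 1 is the second component of the letter x_j. *)
Definition children (j : 'I_p) : seq nat :=
  traject (fun c => (block_end c).+1) j.+1 (x j).2.

Definition cut_children (c : {set 'I_p}) (j : 'I_p) : seq nat :=
  [seq i <- children j | i \in [seq val i | i in c]].

Definition nontotal_cut (c : {set 'I_p}) : bool :=
  [&& [forall i in c, 0 < i]%N,
      [forall j : 'I_p, exists m : 'I_(size (children j)).+1,
         cut_children c j == take m (children j)]
    & [forall i in c, forall j in c, (i != j) ==> ~~ in_block_tail i j]].

Definition LAdm : {set {set 'I_p}} :=
  [set c | nontotal_cut c || (c == [set: 'I_p])].

(* Both words belong to V(A), so that the default value of insubd is unused. *)
Definition block (j : nat) : vmon A := insubd z (block_word j).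

Definition trunk_word (c : {set 'I_p}) : seq (letter A) :=
  [seq lower (size (cut_children c j)) (x j)
     | j : 'I_p <- enum 'I_p & ~~ [exists i in c, in_block j i]].

Definition trunk (c : {set 'I_p}) : vmon A := insubd z (trunk_word c).

Context (k : fieldType).

Definition pruning (c : {set 'I_p}) : PLOT k A :=
  if c == [set: 'I_p] then word k [:: z]
  else \big[@shuffle k A / word k [::]]_(j : 'I_p)
         word k (map block (cut_children c j)).

Definition remainder (c : {set 'I_p}) : PLOT k A :=
  if c == [set: 'I_p] then word k [::] else word k [:: trunk c].

End Cuts.

(* Main.v *)
Require Import Defs.
From HB Require Import structures.
From mathcomp Require Import all_boot all_order all_algebra.
From mathcomp Require Import finmap monalg.
From mathcomp Require Import zify.

(** The formula is checked one coefficient at a time. For words U and V of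
    monomials of V(A), the coefficient of U (x) V in the coproduct of z is the
    coefficient of the one-letter word z in U * V, the product being the sum of
    U_1 (U_2 |> V) over the splittings of U into two complementary subwords.
    Here U_2 |> V is homogeneous, of the same number of factors as V
    ([homog_tri_mon]), so only V = 1, which gives the total cut, and V = v in
    V(A) contribute; in the second case U_1 must be empty, and what is asked for
    is the coefficient of z in U |> v.

    On the word side, U |> v is the sum of all simultaneous graftings of
    u_1, ..., u_n on v: each u_i is attached to a letter of v, and the u_i that
    share a letter are inserted right after it, in increasing order, while the
    index of this letter goes up by their number ([multigrafts],
    [tri_ugens]). This follows from (x X) |> v = x |> (X |> v) - (x |> X) |> v
    by induction on the length of U: grafting x on a simultaneous grafting hits
    either a letter of v or a letter of some u_i, and the second kind of term is
    what gets subtracted ([grafts_multigrafts]). The induction stays among words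
    of monomials of V(A), because V(A) is stable under grafting; and an
    identity between elements of U(g(A)) can be checked after concatenation,
    because V(A) is a prefix code ([to_PN_inj]).

    It remains to count the graftings of U on v that give z. A monomial of V(A)
    is the prefix (Lukasiewicz) code of a plane rooted tree, z_i^a being a
    vertex with i + 1 children; grafting adds leftmost subtrees, and a left-admissible
    cut removes some. Both sides are computed by reading z from left to right
    ([count_multigrafts]). At a letter x_j which is kept, one chooses the number
    m of its first children that are cut, skips their blocks, and goes on with a
    cut of the remaining suffix ([big_partial_cut]). On the grafting side, one
    chooses the u_i attached to the first letter of v: the result agrees with z
    there exactly when they are the first m blocks after x_j and this letter is
    x_j lowered by m. The shuffles in the pruned part account for the ways of
    distributing the u_i among the letters of v, since the coefficient of U in
    the shuffle of s and t is the number of splittings of U into s and t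
    ([count_shuffles]). *)

Set Implicit Arguments.
Unset Strict Implicit.
Unset Printing Implicit Defensive.

Import Order.TTheory GRing.Theory Num.Theory.
Local Open Scope ring_scope.

(** * Prefix codes of plane forests *)

Section Forests.

Context (A : finType).
Implicit Types (n m : nat) (u w t : seq (letter A)).

(** Concatenations of n monomials of V(A), recognised letter by letter: n is the
    number of trees still to be read, and a letter z_{b-1}^a replaces one
    expected tree by b of them. *)
Fixpoint forest n w : bool :=
  if w is y :: w' then (0 < n)%N && forest (n.-1 + y.2) w' else n == 0%N.

Lemma forest_cat m n u w : forest m u -> forest (m + n) (u ++ w) = forest n w.
Proof.
elim: u m => [|y u IH] m /=; first by move/eqP->.
by case: m => //= m /IH <-; rewrite addnAC.
Qed.

Lemma forest_split m n w : forest (m + n) w ->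
  exists u t, [/\ w = u ++ t, forest m u & forest n t].
Proof.
elim: w m => [|y w IH] [|m] //=; [by exists [::], [::]| |].
  by rewrite add0n => h; exists [::], (y :: w).
rewrite addnAC => /IH [u [t [-> hu ht]]].
by exists (y :: u), t.
Qed.

(** V(A) is a prefix code: the number of trees alone determines where the
    reading stops. *)
Lemma forest_cat_inj m u u' t t' :
  forest m u -> forest m u' -> u ++ t = u' ++ t' -> u = u' /\ t = t'.
Proof.
elim: u u' m => [|y u IH] [|y' u'] [|m] //= hu hu' [ey e]; subst y'.
by have [-> ->] := IH _ _ hu hu' e.
Qed.

Lemma wt_nil : wt ([::] : seq (letter A)) = 0.
Proof. by rewrite /wt big_nil. Qed.

Lemma wt_cons (y : letter A) w : wt (y :: w) = lwt y + wt w.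
Proof. by rewrite /wt big_cons. Qed.

Lemma lwtE (y : letter A) : lwt y = y.2%:Z - 1.
Proof. by []. Qed.

(** The number of trees still expected after a prefix u is n + wt u; it must
    stay positive until it reaches 0 at the end. *)
Lemma forest_wt n w : forest n w = (wt w == - n%:Z) &&
  all (fun q => - n%:Z < wt (take q w)) (iota 0 (size w)).
Proof.
elim: w n => [|y w IH] n; first by rewrite wt_nil /= andbT; lia.
rewrite /= (iotaDl 1 0) all_map wt_nil wt_cons IH.
case: n => [|n] /=; first by rewrite andbF.
rewrite lwtE; congr andb; first by lia.
by apply: eq_all => q /=; rewrite wt_cons lwtE add0n; lia.
Qed.

Lemma in_VE w : in_V w = forest 1 w.
Proof.
rewrite forest_wt /in_V; case: w => [|y w] /=; first by rewrite wt_nil.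
rewrite wt_nil /=; congr andb.
Qed.

Lemma forest_gt0 n w : forest n w -> (0 < size w)%N = (0 < n)%N.
Proof. by case: w n => [|y w] [|n]. Qed.

(** The search that defines the end of a block stops at the end of the first
    tree of the forest. *)
Lemma find_block n w
    (s := find (fun m => wt (take m.+1 w) == -1) (iota 0 (size w))) :
  forest n.+1 w ->
  [/\ (s < size w)%N, forest 1 (take s.+1 w) & forest n (drop s.+1 w)].
Proof.
rewrite -add1n => /(@forest_split 1) [u [t [ew hu ht]]].
have hs : (0 < size u)%N by rewrite (forest_gt0 hu).
suff -> : s = (size u).-1.
  rewrite prednK // ew take_size_cat // drop_size_cat // size_cat.
  by split=> //; lia.
have hu' := hu; rewrite forest_wt in hu'.
case/andP: hu' => /eqP wu /allP uP.
have -> : s = find (fun m => wt (take m.+1 w) == -1)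
    (iota 0 (size u).-1 ++ iota (size u).-1 (size w - (size u).-1)).
  rewrite -iotaD subnKC // ew size_cat; lia.
rewrite find_cat ifN; last first.
  apply/hasPn => m; rewrite mem_iota => /andP[_ hm].
  have hm' : (m.+1 < size u)%N by lia.
  rewrite ew takel_cat; last by lia.
  have := uP m.+1; rewrite mem_iota => /(_ hm'); lia.
rewrite size_iota.
have -> : (size w - (size u).-1 = (size w - size u).+1)%N.
  by rewrite ew size_cat; lia.
rewrite /= prednK // ew take_size_cat // wu eqxx; lia.
Qed.

End Forests.

(** * Splittings of a word into two subwords *)

Lemma filter_nil (T : eqType) (a : pred T) (s : seq T) :
  {in s, forall x, ~~ a x} -> filter a s = [::].
Proof.
by move=> h; apply/eqP; rewrite -[_ == _]negbK -has_filter; apply/hasPn.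
Qed.

Section Splits.

Context (T : eqType).
Implicit Types (U V : seq T).

(** The 2 ^ size U ways of distributing the positions of U, counted with
    multiplicity: this is the coproduct that makes each letter primitive. *)
Fixpoint splits U : seq (seq T * seq T) :=
  if U is x :: U' then
    [seq (x :: p.1, p.2) | p <- splits U']
      ++ [seq (p.1, x :: p.2) | p <- splits U']
  else [:: ([::], [::])].

Lemma big_splits_cons (M : nmodType) x U (F : seq T * seq T -> M) :
  \sum_(p <- splits (x :: U)) F p =
  \sum_(p <- splits U) (F (x :: p.1, p.2) + F (p.1, x :: p.2)).
Proof. by rewrite /= big_cat !big_map big_split. Qed.

Lemma big_splits_nil (M : nmodType) U (F : seq T -> M) :
  \sum_(p <- splits U | p.1 == [::]) F p.2 = F U.
Proof.
elim: U F => [|x U IH] F; first by rewrite /= big_mkcond big_seq1.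
rewrite /= big_cat !big_map /= big_pred0_eq add0r.
by rewrite (IH (fun u => F (x :: u))).
Qed.

Lemma big_splits_nilr (M : nmodType) U (F : seq T -> M) :
  \sum_(p <- splits U | p.2 == [::]) F p.1 = F U.
Proof.
elim: U F => [|x U IH] F; first by rewrite /= big_mkcond big_seq1.
rewrite /= big_cat !big_map /= big_pred0_eq addr0.
by rewrite (IH (fun u => F (x :: u))).
Qed.

Lemma count_mem_map_cons (x y : T) V (L : seq (seq T)) :
  count_mem (x :: V) (map (cons y) L) = ((y == x) * count_mem V L)%N.
Proof.
rewrite count_map; have [->|ne] := eqVneq y x.
  by rewrite mul1n; apply: eq_count => W /=; rewrite eqseq_cons eqxx.
rewrite (@eq_count _ _ pred0) ?count_pred0 // => W /=.
by rewrite eqseq_cons (negbTE ne).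
Qed.

Lemma count_splits_cons (x : T) U (s t : seq T) :
  count_mem (s, t) (splits (x :: U)) =
  ((if s is a :: s' then (x == a) * count_mem (s', t) (splits U) else 0)
   + (if t is b :: t' then (x == b) * count_mem (s, t') (splits U) else 0))%N.
Proof.
rewrite /= count_cat !count_map; congr addn.
  case: s => [|a s].
    by rewrite (@eq_count _ _ pred0) ?count_pred0.
  have [->|ne] := eqVneq x a.
    rewrite mul1n; apply: eq_count => -[p q] /=.
    by rewrite !xpair_eqE eqseq_cons eqxx.
  rewrite (@eq_count _ _ pred0) ?count_pred0 // => -[p q] /=.
  by rewrite xpair_eqE eqseq_cons (negbTE ne).
case: t => [|b t].
  rewrite (@eq_count _ _ pred0) ?count_pred0 // => -[p q] /=.
  by rewrite xpair_eqE andbF.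
have [->|ne] := eqVneq x b.
  rewrite mul1n; apply: eq_count => -[p q] /=.
  by rewrite !xpair_eqE eqseq_cons eqxx.
rewrite (@eq_count _ _ pred0) ?count_pred0 // => -[p q] /=.
by rewrite xpair_eqE eqseq_cons (negbTE ne) andbF.
Qed.

(** Shuffling is dual to splitting. *)
Lemma count_shuffles (s t U : seq T) :
  count_mem U (shuffles s t) = count_mem (s, t) (splits U).
Proof.
elim: U s t => [|x U IH] s t.
  case: s => [|a s]; case: t => [|b t] //=.
  rewrite count_cat !count_map !(@eq_count _ _ pred0) ?count_pred0 //.
rewrite count_splits_cons.
case: s => [|a s]; case: t => [|b t] //.
- rewrite -IH /= !addn0 add0n eqseq_cons (eq_sym x).
  by case: eqP; rewrite ?mul1n ?mul0n.
- rewrite /= !addn0 -IH eqseq_cons (eq_sym x).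
  case: eqP; rewrite ?mul1n ?mul0n //.
  by case: s => [|? ?] /=; rewrite addn0.
by rewrite /= count_cat !count_mem_map_cons -!IH (eq_sym a) (eq_sym b).
Qed.

Lemma size_splits U (p : seq T * seq T) :
  p \in splits U -> (size p.1 + size p.2)%N = size U.
Proof.
elim: U p => [|y U IH] p /=; first by rewrite inE => /eqP ->.
by rewrite mem_cat => /orP[] /mapP[q /IH <- ->] /=; rewrite ?addnS.
Qed.

Lemma all_splits (P : pred T) U (p : seq T * seq T) :
  all P U -> p \in splits U -> all P p.1 && all P p.2.
Proof.
elim: U p => [|u U IH] p /=; first by rewrite inE => _ /eqP->.
case/andP=> hu hU; rewrite mem_cat => /orP[] /mapP[q /(IH _ hU) h ->] /=;
  by rewrite hu ?andbT.
Qed.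

End Splits.

Lemma splits_map (T T' : eqType) (f : T -> T') (U : seq T) :
  splits (map f U) = [seq (map f q.1, map f q.2) | q <- splits U].
Proof.
by elim: U => //= x U ->; rewrite map_cat -!map_comp.
Qed.

(** * Graftings of words *)

Section Grafts.

Context (A : finType).
Implicit Types (x y w t : seq (letter A)) (U : seq (seq (letter A))).

(** The summands of the product x |> y for x of weight -1: in [raise 1], the
    exponent of the derivation is - wt x. *)
Fixpoint grafts x y : seq (seq (letter A)) :=
  if y is a :: y' then
    (raise 1 a :: x ++ y') :: map (cons a) (grafts x y')
  else [::].

(** Each word of U goes right after a letter of y, several words after the same
    letter keeping their order in U. *)
Fixpoint multigrafts U y : seq (seq (letter A)) :=
  if y is a :: y' then
    [seq raise (size p.1) a :: flatten p.1 ++ t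
       | p <- splits U, t <- multigrafts p.2 y']
  else if U is [::] then [:: [::]] else [::].

(** The derivation of the concatenation of words that extends x |> _. *)
Fixpoint subgrafts x U : seq (seq (seq (letter A))) :=
  if U is u :: U' then
    [seq t :: U' | t <- grafts x u] ++ [seq u :: V | V <- subgrafts x U']
  else [::].

Lemma grafts_cat x y w :
  grafts x (y ++ w) =
  [seq t ++ w | t <- grafts x y] ++ map (cat y) (grafts x w).
Proof.
elim: y => [|a y IH] /=; first by elim: (grafts x w) => //= ? ? <-.
by rewrite IH map_cat -catA -!map_comp.
Qed.

Lemma grafts_flatten x U : grafts x (flatten U) = map flatten (subgrafts x U).
Proof.
elim: U => //= u U IH.
by rewrite grafts_cat IH map_cat -!map_comp.
Qed.

Lemma size_subgrafts x U V : V \in subgrafts x U -> size V = size U.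
Proof.
elim: U V => //= u U IH V; rewrite mem_cat => /orP[] /mapP[V' hV' ->] //=.
by rewrite IH.
Qed.

Lemma big_subgrafts_cons (M : nmodType) x u U (F : _ -> M) :
  \sum_(V <- subgrafts x (u :: U)) F V =
  \sum_(t <- grafts x u) F (t :: U) + \sum_(V <- subgrafts x U) F (u :: V).
Proof. by rewrite /= big_cat !big_map. Qed.

(** A map that acts on one letter at a time is a coderivation for splittings. *)
Lemma big_splits_subgrafts (M : nmodType) x U F :
  \sum_(V <- subgrafts x U) \sum_(p <- splits V) F p =
  \sum_(p <- splits U) (\sum_(V <- subgrafts x p.1) F (V, p.2) +
                        \sum_(V <- subgrafts x p.2) F (p.1, V)) :> M.
Proof.
elim: U F => [|u U IH] F; first by rewrite /= big_seq1 /= !big_nil addr0.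
rewrite big_splits_cons big_subgrafts_cons.
under [X in X + _]eq_bigr do rewrite big_splits_cons.
under [X in _ + X]eq_bigr do rewrite big_splits_cons.
rewrite IH exchange_big -big_split /=; apply: eq_bigr => p _.
rewrite !big_subgrafts_cons !big_split /= -!addrA; congr (_ + _).
set a := (\sum_(i <- grafts x u) _); set b := \sum_(i <- _) F _.
set c := \sum_(i <- _) F _; set d := \sum_(i <- _) F _.
set e := \sum_(i <- _) F _.
rewrite addrCA; congr (_ + _); rewrite addrCA [RHS]addrCA; congr (_ + _).
exact: addrCA.
Qed.

Lemma raise_raise n m (a : letter A) : raise n (raise m a) = raise (m + n) a.
Proof. by rewrite /raise /= addnA. Qed.

(** A letter of a simultaneous grafting of U on y comes either from y or from
    some word u of U. Grafting x after the former adds x in front of the words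
    attached to that letter, hence the simultaneous grafting of x :: U; grafting
    x after the latter amounts to grafting it on u beforehand. *)
Lemma grafts_multigrafts (M : nmodType) x U y (F : seq (letter A) -> M) :
  \sum_(w <- multigrafts U y) \sum_(t <- grafts x w) F t =
  \sum_(t <- multigrafts (x :: U) y) F t +
  \sum_(V <- subgrafts x U) \sum_(t <- multigrafts V y) F t.
Proof.
elim: y U F => [|a y IH] U F.
  rewrite /= big_nil add0r; case: U => [|u U] /=.
    by rewrite big_seq1 !big_nil.
  rewrite big_nil big_cat !big_map big1 => [|? _]; last by rewrite big_nil.
  by rewrite big1 => [|? _]; rewrite ?big_nil /= ?addr0.
have multiE U' (H : seq (letter A) -> M) :
  \sum_(t <- multigrafts U' (a :: y)) H t =
  \sum_(p <- splits U') \sum_(t <- multigrafts p.2 y)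
     H (raise (size p.1) a :: flatten p.1 ++ t).
  by rewrite /= big_allpairs_dep.
rewrite !multiE; under [X in _ = _ + X]eq_bigr do rewrite multiE.
rewrite big_splits_subgrafts big_splits_cons -big_split /=.
apply: eq_bigr => -[P Q] _ /=.
under eq_bigr do rewrite /= big_cons raise_raise addn1 big_map grafts_cat.
rewrite big_split /= -!addrA; congr (_ + _).
  by apply: eq_bigr=> t _; rewrite catA.
under eq_bigr do rewrite big_cat !big_map grafts_flatten big_map /=.
rewrite big_split /= addrCA; congr (_ + _).
  rewrite exchange_big /=; apply: eq_big_seq => V /size_subgrafts hV.
  by rewrite hV.
by rewrite (IH Q (fun t => F (raise (size P) a :: flatten P ++ t))).
Qed.

Lemma multigrafts_nil y : multigrafts [::] y = [:: y].
Proof.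
elim: y => //= a y ->; rewrite /= /raise addn0.
by case: a.
Qed.

Lemma forest_raise n m a y : forest n (raise m a :: y) =
  (0 < n)%N && forest (m + (n.-1 + a.2)) y.
Proof. by rewrite /= addnA addnC. Qed.

(** Grafting a tree on a letter of a forest adds a leftmost child, so the number
    of trees does not change. *)
Lemma forest_grafts n x y t :
  forest 1 x -> forest n y -> t \in grafts x y -> forest n t.
Proof.
move=> hx; elim: y n t => //= a y IH [|n] t //= hy.
rewrite inE => /orP[/eqP ->|/mapP[t' /(IH _ _ hy) h ->]] //.
by rewrite forest_raise /= (forest_cat _ _ hx).
Qed.

Lemma forest_flatten U : all (forest 1) U -> forest (size U) (flatten U).
Proof.
elim: U => //= u U IH /andP[hu /IH hU].
by rewrite -add1n (forest_cat _ _ hu).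
Qed.

Lemma all_subgrafts x U V :
  forest 1 x -> all (forest 1) U -> V \in subgrafts x U -> all (forest 1) V.
Proof.
move=> hx; elim: U V => //= u U IH V /andP[hu hU].
rewrite mem_cat => /orP[] /mapP[t ht ->] /=; last by rewrite hu IH.
by rewrite hU (forest_grafts hx hu).
Qed.

Lemma forest_multigrafts n U y t :
  all (forest 1) U -> forest n y -> t \in multigrafts U y -> forest n t.
Proof.
elim: y n U t => [|a y IH] n U t hU /=.
  by case: U hU => // _ h; rewrite inE => /eqP ->.
case: n => //= n hy /allpairsPdep[p [w [hp hw ->]]].
have /andP[h1 h2] := all_splits hU hp.
rewrite forest_raise /= forest_cat ?forest_flatten //.
exact: IH hw.
Qed.

End Grafts.

(** * Coefficients in free modules *)

Section FreeModuleTheory.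

Context (k : fieldType).

Lemma lin_extEw (T : choiceType) (M : lmodType k) (f : T -> M)
    (d : {fset T}) (x : {malg k[T]}) :
  (msupp x `<=` d)%fset -> lin_ext f x = \sum_(t <- d) x@_t *: f t.
Proof.
move=> le; rewrite /lin_ext (big_fset_incl _ le) // => t _ /mcoeff_outdom ->.
by rewrite scale0r.
Qed.

Fact lin_ext_is_linear (T : choiceType) (M : lmodType k) (f : T -> M) :
  linear (lin_ext f).
Proof.
move=> a x y.
pose d := (msupp x `|` msupp y)%fset.
have hx : (msupp x `<=` d)%fset by apply: fsubsetUl.
have hy : (msupp y `<=` d)%fset by apply: fsubsetUr.
have hxy : (msupp (a *: x + y) `<=` d)%fset.
  apply: fsubset_trans (msuppD_le _ _) _; apply: fsetSU; exact: msuppZ_le.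
rewrite (lin_extEw _ hx) (lin_extEw _ hy) (lin_extEw _ hxy).
rewrite scaler_sumr -big_split /=; apply: eq_bigr => t _.
by rewrite mcoeffD mcoeffZ scalerDl scalerA.
Qed.

HB.instance Definition _ (T : choiceType) (M : lmodType k) (f : T -> M) :=
  GRing.isLinear.Build k {malg k[T]} M *:%R (lin_ext f) (lin_ext_is_linear f).

Lemma lin_extU (T : choiceType) (M : lmodType k) (f : T -> M) t :
  lin_ext f << t >> = f t.
Proof. by rewrite /lin_ext msuppU oner_eq0 big_seq_fset1 mcoeffUU scale1r. Qed.

Lemma sum_mcoeff_delta (T : choiceType) (x : {malg k[T]}) t :
  \sum_(s <- msupp x) x@_s * (s == t)%:R = x@_t.
Proof.
rewrite [in RHS](monalgE x) raddf_sum /=; apply: eq_bigr => s _.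
by rewrite mcoeffU mulr_natr.
Qed.

Lemma pairingUl (T : choiceType) t (y : {malg k[T]}) : pairing << t >> y = y@_t.
Proof. by rewrite /pairing msuppU oner_eq0 big_seq_fset1 mcoeffUU mul1r. Qed.

Lemma pairingUr (T : choiceType) t (x : {malg k[T]}) : pairing x << t >> = x@_t.
Proof.
rewrite -[RHS]sum_mcoeff_delta; apply: eq_bigr => s _.
by rewrite mcoeffU eq_sym.
Qed.

Lemma tensorUU (S T : choiceType) s t :
  tensor (<< s >> : {malg k[S]}) (<< t >> : {malg k[T]}) = << (s, t) >>.
Proof. by rewrite /tensor /lin_ext2 !lin_extU. Qed.

Lemma mcoeff_tensorU (S T : choiceType) (x : {malg k[S]}) (t : T) s t' :
  (tensor x << t >>)@_(s, t') = x@_s * (t == t')%:R.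
Proof.
rewrite /tensor /lin_ext2 {1}/lin_ext raddf_sum -[x@_s]sum_mcoeff_delta.
rewrite mulr_suml; apply: eq_bigr => r _.
by rewrite /= lin_extU mcoeffZ mcoeffU xpair_eqE -mulnb natrM mulrA.
Qed.

Lemma malg_mulUU (K : monomType) (s t : K) :
  << s >> * << t >> = << mmul s t >> :> {malg k[K]}.
Proof. by rewrite malgM_def fgmulUU mulr1. Qed.

End FreeModuleTheory.

(** * The enveloping algebra as a free algebra *)

Section EnvelopingAlgebra.

Context (k : fieldType) (A : finType).
Implicit Types (U V : seq (vmon A)) (u v z : vmon A).
Implicit Types (t x y : seq (letter A)) (S : seq (seq (letter A))).

Local Notation mon U := (<< FMonom U : Wmon A >> : Ug k A).

Lemma mon_nil : mon [::] = 1.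
Proof. by congr << _ >>; rewrite /mone /= fmoneE. Qed.

Lemma mon_cat U V : mon (U ++ V) = mon U * mon V.
Proof. by rewrite malg_mulUU; congr << _ >>; rewrite /mmul /= fmmulE. Qed.

Lemma mon_cons v U : mon (v :: U) = vgen k v * mon U.
Proof. exact: (mon_cat [:: v]). Qed.

Lemma mcoeff_mon U V : (mon U)@_(FMonom V) = (U == V)%:R.
Proof. by rewrite mcoeffU. Qed.

Lemma unshuffle_mon U :
  unshuffle (mon U) = \sum_(p <- splits U) << (FMonom p.1, FMonom p.2) >>.
Proof.
rewrite /unshuffle lin_extU /=; elim: U => [|v U IH].
  rewrite big_nil big_seq1 /=; congr << _ >>.
  by rewrite /mone /= /pair_one /mone /= fmoneE.
rewrite big_cons IH big_splits_cons mulr_sumr; apply: eq_bigr => -[p q] _.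
have el : tensor (vgen k v) (1 : Ug k A) = << (FMonom [:: v], FMonom [::]) >>.
  by rewrite -mon_nil; apply: tensorUU.
have er : tensor (1 : Ug k A) (vgen k v) = << (FMonom [::], FMonom [:: v]) >>.
  by rewrite -mon_nil; apply: tensorUU.
rewrite el er mulrDl.
by congr (_ + _); rewrite malg_mulUU; congr << _ >>;
  rewrite /mmul /= /pair_mul /mmul /= !fmmulE.
Qed.

Lemma sweedler_mon (M : lmodType k) (F : Ug k A -> Ug k A -> M) U :
  sweedler F (mon U) = \sum_(p <- splits U) F (mon p.1) (mon p.2).
Proof.
rewrite /sweedler unshuffle_mon linear_sum; apply: eq_bigr => p _.
by rewrite /= lin_extU.
Qed.

(** The generator attached to a word, with the junk value 0 outside V(A); it
    allows sums over lists of graftings without membership proofs. *)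
Definition ugen t : Ug k A := oapp (@vgen k A) 0 (insub t).

Definition ugens S : Ug k A := \prod_(t <- S) ugen t.

Lemma ugen_vmon v : ugen v = vgen k v.
Proof. by rewrite /ugen valK. Qed.

Lemma ugen_in_V t (ht : in_V t) : ugen t = vgen k (Sub t ht : vmon A).
Proof. by rewrite -ugen_vmon SubK. Qed.

Lemma ugens_vmon U : ugens (map val U) = mon U.
Proof.
rewrite /ugens big_map; elim: U => [|v U IH]; first by rewrite big_nil mon_nil.
by rewrite big_cons IH ugen_vmon mon_cons.
Qed.

Lemma ugens_cons t S : ugens (t :: S) = ugen t * ugens S.
Proof. exact: big_cons. Qed.

Lemma mcoeff_ugen t z : (ugen t)@_(FMonom [:: z]) = (t == z)%:R.
Proof.
rewrite /ugen; case: insubP => [v _ <-|ht] /=.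
  by rewrite /vgen mcoeff_mon eqseq_cons andbT.
rewrite mcoeff0; case: eqP => // e; move: ht; rewrite e (valP z) //.
Qed.

Lemma vmon_forest v : forest 1 v.
Proof. by rewrite -in_VE (valP v). Qed.

(** This provides the default value of nth on letters, as A may be empty. *)
Lemma vmon_letter v : exists x0 : letter A, x0 \in vword v.
Proof.
by case: (vword v) (vmon_forest v) => // x0 w _; exists x0; rewrite mem_head.
Qed.

Lemma concat_inj : injective (@concat A).
Proof.
move=> [U] [V]; rewrite /concat /= => e; congr FMonom.
elim: U V e => [|u U IH] [|v V] //=.
- by move=> e; have := vmon_forest v; case: (vword v) e.
- by move=> e; have := vmon_forest u; case: (vword u) e.
by move/(forest_cat_inj (vmon_forest u) (vmon_forest v))
  => [/val_inj -> /IH ->].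
Qed.

Lemma flatten_vmon_inj U V t t' : size U = size V ->
  flatten (map val U) ++ t = flatten (map val V) ++ t' -> U = V /\ t = t'.
Proof.
elim: U V => [|u U IH] [|v V] //= [e].
rewrite -!catA => /(forest_cat_inj (vmon_forest u) (vmon_forest v)).
by case=> /val_inj -> /(IH _ e)[-> ->].
Qed.

(** A product of monomials of V(A) can be read off its concatenation, so the map
    sends basis words to distinct basis words. *)
Lemma to_PN_inj : injective (@to_PN k A).
Proof.
have H (X : Ug k A) (w : Wmon A) : (to_PN X)@_(FMonom (concat w)) = X@_w.
  rewrite /to_PN /lin_ext raddf_sum -[RHS]sum_mcoeff_delta.
  apply: eq_bigr => s _; rewrite /= mcoeffZ mcoeffU.
  congr (_ * _%:R); congr nat_of_bool; apply/eqP/eqP=> [[e]|-> //].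
  exact: concat_inj e.
by move=> X Y e; apply/malgP => w; rewrite -!H e.
Qed.

Lemma to_PN_ugen t : in_V t -> to_PN (ugen t) = << FMonom t >>.
Proof.
move=> ht; rewrite /ugen insubT /= /to_PN lin_extU.
by rewrite /concat /= cats0.
Qed.

Lemma big_grafts (M : nmodType) x y (F : seq (letter A) -> M) :
  \sum_(t <- grafts x y) F t =
  \sum_(j < size y) F (take j y ++ raise 1 (tnth (in_tuple y) j) :: x
                       ++ drop j.+1 y).
Proof.
elim: y F => [|a y IH] F /=; first by rewrite big_nil big_ord0.
rewrite big_cons big_map IH big_ord_recl /= drop0; congr (_ + _).
by apply: eq_bigr => j _; rewrite !(tnth_nth a).
Qed.

Lemma wgraft_vgen u v :
  wgraft (to_PN (vgen k u)) (to_PN (vgen k v)) =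
  \sum_(t <- grafts u v) << FMonom t >>.
Proof.
rewrite -!ugen_vmon !to_PN_ugen ?(valP u) ?(valP v) //.
rewrite /wgraft /lin_ext2 !lin_extU /= big_grafts /wgraft_word.
have -> : wt u = -1 by have /andP[/eqP] := valP u.
by [].
Qed.

End EnvelopingAlgebra.

(** * The extended post-Lie product on monomials *)

Section PostLieAction.

Context (k : fieldType) (A : finType).
Implicit Types (U V : seq (vmon A)) (u v z : vmon A).
Implicit Types (t x y : seq (letter A)) (S : seq (seq (letter A))).

Local Notation mon U := (<< FMonom U : Wmon A >> : Ug k A).
Local Notation ugen := (ugen k).
Local Notation ugens := (ugens k).

Context (tri : Ug k A -> Ug k A -> Ug k A) (trip : postlie_extension tri).

Lemma tri0r X : tri X 0 = 0.
Proof.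
apply: (addrI (tri X 0)); rewrite addr0.
by have := tri_linearr trip 1 X 0 0; rewrite !scale1r addr0.
Qed.

Lemma tri0l X : tri 0 X = 0.
Proof.
apply: (addrI (tri 0 X)); rewrite addr0.
by have := tri_linearl trip 1 0 0 X; rewrite !scale1r addr0.
Qed.

Lemma tri_sumr (I : Type) (r : seq I) X F :
  tri X (\sum_(i <- r) F i) = \sum_(i <- r) tri X (F i).
Proof.
apply: (big_morph (tri X) _ (tri0r X)) => Y Z.
by have := tri_linearr trip 1 X Y Z; rewrite !scale1r.
Qed.

Lemma tri_suml (I : Type) (r : seq I) X F :
  tri (\sum_(i <- r) F i) X = \sum_(i <- r) tri (F i) X.
Proof.
apply: (big_morph (tri^~ X) _ (tri0l X)) => Y Z.
by have := tri_linearl trip 1 Y Z X; rewrite !scale1r.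
Qed.

Lemma in_g_vgen v : in_g (vgen k v).
Proof. by apply: LieGen; exists v. Qed.

Lemma tri_vgen u v :
  tri (vgen k u) (vgen k v) = \sum_(t <- grafts u v) ugen t.
Proof.
apply: to_PN_inj; have [_ ->] := tri_g trip (in_g_vgen u) (in_g_vgen v).
rewrite wgraft_vgen /to_PN linear_sum /=; apply: eq_big_seq => t ht.
rewrite -/(to_PN _) to_PN_ugen // in_VE.
exact: forest_grafts (vmon_forest u) (vmon_forest v) ht.
Qed.

Lemma tri_monM U Y Z : tri (mon U) (Y * Z) =
  \sum_(p <- splits U) tri (mon p.1) Y * tri (mon p.2) Z.
Proof. by rewrite (tri_Mr trip) sweedler_mon. Qed.

(** X |> 1 = X |> (1 1) is the sum of (X_(1) |> 1) (X_(2) |> 1). By induction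
    only the two trivial splittings survive, so that a := X |> 1 satisfies
    a = a + a when X is a nonempty word. *)
Lemma tri_mon1 U : tri (mon U) 1 = (U == [::])%:R.
Proof.
have [n] := ubnP (size U); elim: n U => // n IH [|x U] /= hU.
  by rewrite mon_nil (tri_1 trip).
have E : tri (mon (x :: U)) 1 = tri (mon (x :: U)) 1 + tri (mon (x :: U)) 1.
  transitivity (tri (mon (x :: U)) (1 * 1)); first by rewrite mulr1.
  rewrite tri_monM big_splits_cons big_split /=.
  have szp p : p \in splits U -> (size p.1 < n)%N && (size p.2 < n)%N.
    move=> /size_splits e; rewrite ltnS -e in hU.
    by rewrite !(leq_ltn_trans _ hU) ?leq_addr ?leq_addl.
  apply: (congr2 +%R).
    rewrite -[RHS](big_splits_nilr U (fun W => tri (mon (x :: W)) 1)).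
    rewrite [RHS]big_mkcond /=; apply: eq_big_seq => p hp.
    have /andP[_ h2] := szp _ hp.
    by rewrite (IH _ h2); case: eqP; rewrite ?mulr1 ?mulr0.
  rewrite -[RHS](big_splits_nil U (fun W => tri (mon (x :: W)) 1)).
  rewrite [RHS]big_mkcond /=; apply: eq_big_seq => p hp.
  have /andP[h2 _] := szp _ hp.
  by rewrite (IH _ h2); case: eqP; rewrite ?mul1r ?mul0r.
by apply: (addrI (tri (mon (x :: U)) 1)); rewrite addr0 -E.
Qed.

Lemma tri_vgenM v Y Z :
  tri (vgen k v) (Y * Z) = tri (vgen k v) Y * Z + Y * tri (vgen k v) Z.
Proof.
rewrite -[vgen k v]/(mon [:: v]) tri_monM big_splits_cons big_seq1 /=.
by rewrite mon_nil !(tri_1 trip).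
Qed.

Lemma tri_vgen_ugens v S : all (@in_V A) S ->
  tri (vgen k v) (ugens S) = \sum_(T <- subgrafts v S) ugens T.
Proof.
elim: S => [|t S IH] /=.
  by rewrite /ugens !big_nil => _; exact: (tri_mon1 [:: v]).
case/andP=> ht hS; rewrite ugens_cons tri_vgenM IH // big_subgrafts_cons.
rewrite (ugen_in_V k ht) tri_vgen mulr_suml mulr_sumr.
congr (_ + _); apply: eq_bigr => w _; first by rewrite ugens_cons.
by rewrite ugens_cons (ugen_in_V k ht).
Qed.

(** In (x X) |> y = x |> (X |> y) - (x |> X) |> y, the word x |> X has the same
    number of factors as X, so that the induction hypothesis applies to both
    terms; the difference is given by [grafts_multigrafts]. *)
Lemma tri_ugens S y : all (@in_V A) S -> in_V y ->
  tri (ugens S) (ugen y) = \sum_(t <- multigrafts S y) ugen t.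
Proof.
have [n] := ubnP (size S); elim: n S => // n IH [|x S] /= hn.
  by rewrite /ugens big_nil (tri_1 trip) multigrafts_nil big_seq1.
case/andP=> hx hS hy; rewrite ugens_cons (ugen_in_V k hx).
have gy : in_g (ugen y) by rewrite (ugen_in_V k hy); exact: in_g_vgen.
rewrite (tri_Ml trip _ (in_g_vgen _) gy) (IH S) // tri_sumr.
rewrite tri_vgen_ugens // tri_suml /=.
have hS' : all (forest 1) S by rewrite -(eq_all (@in_VE A)).
have hx' : forest 1 x by rewrite -in_VE.
have hy' : forest 1 y by rewrite -in_VE.
apply/eqP; rewrite subr_eq; apply/eqP.
transitivity (\sum_(w <- multigrafts S y) \sum_(t <- grafts x w) ugen t).
  apply: eq_big_seq => t ht.
  have ht' : in_V t by rewrite in_VE (forest_multigrafts hS' hy' ht).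
  by rewrite (ugen_in_V k ht') tri_vgen.
rewrite grafts_multigrafts; congr (_ + _); apply: eq_big_seq => T hT.
rewrite IH ?(size_subgrafts hT) //.
by rewrite (eq_all (@in_VE A)) (all_subgrafts hx' hS' hT).
Qed.

End PostLieAction.

(** * Coefficients of the product dual to the coproduct *)

Section StarCoefficients.

Context (k : fieldType) (A : finType).
Implicit Types (U V : seq (vmon A)) (u v z : vmon A).

Local Notation mon U := (<< FMonom U : Wmon A >> : Ug k A).

Context (tri : Ug k A -> Ug k A -> Ug k A) (trip : postlie_extension tri).

Lemma star_mon U Y :
  star tri (mon U) Y = \sum_(p <- splits U) mon p.1 * tri (mon p.2) Y.
Proof. by rewrite /star sweedler_mon. Qed.

Definition homog (n : nat) (X : Ug k A) : Prop :=
  forall w : Wmon A, size w != n -> X@_w = 0.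

Lemma homog_sum n (I : Type) (r : seq I) (P : pred I) F :
  (forall i, P i -> homog n (F i)) -> homog n (\sum_(i <- r | P i) F i).
Proof.
by move=> h w hw; rewrite raddf_sum big1 // => i /h hi; apply: hi.
Qed.

Lemma homog_mon U : homog (size U) (mon U).
Proof.
move=> w hw; rewrite mcoeffU; have [e|_] := eqVneq; last by rewrite mulr0n.
by rewrite -e eqxx in hw.
Qed.

Lemma homogM n m X Y : homog n X -> homog m Y -> homog (n + m) (X * Y).
Proof.
move=> hX hY w hw; rewrite mcoeffMl; apply: big1 => s _; apply: big1 => t _.
have [e|_] := eqVneq (mmul s t) w; last by rewrite mulr0n.
have [hs|hs] := eqVneq (size s) n; last by rewrite (hX _ hs) mul0r mul0rn.
have [ht|ht] := eqVneq (size t) m; last by rewrite (hY _ ht) mulr0 mul0rn.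
by move: hw; rewrite -e /mmul /= fmmulE size_cat hs ht eqxx.
Qed.

Lemma homog_ugen t : homog 1 (ugen k t).
Proof.
rewrite /ugen; case: insubP => [v _ _|_] /=; first exact: (@homog_mon [:: v]).
by move=> w _; rewrite mcoeff0.
Qed.

Lemma tri_mon_vgen U v : tri (mon U) (vgen k v) =
  \sum_(t <- multigrafts (map val U) v) ugen k t.
Proof.
rewrite -ugens_vmon -ugen_vmon (tri_ugens trip) ?(valP v) //.
by apply/allP => _ /mapP[u _ ->]; exact: (valP u).
Qed.

(** Acting on a product distributes the letters of U among its factors, and each
    factor stays a combination of elements of V(A). *)
Lemma homog_tri_mon U V : homog (size V) (tri (mon U) (mon V)).
Proof.
elim: V U => [|v V IH] U.
  rewrite mon_nil (tri_mon1 trip); case: eqP => [_|_ w _]; last exact: mcoeff0.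
  by rewrite -mon_nil; exact: homog_mon.
rewrite mon_cons (tri_monM trip) /= -add1n; apply: homog_sum => p _.
apply: homogM; last exact: IH.
by rewrite tri_mon_vgen; apply: homog_sum => t _; exact: homog_ugen.
Qed.

(** By homogeneity, a word of length one can only come from V = 1, or from V of
    length one and the splitting of U whose left part is empty. *)
Lemma mcoeff_star_mon z U V :
  (star tri (mon U) (mon V))@_(FMonom [:: z]) =
  match V with
  | [::] => (U == [:: z])%:R
  | [:: v] => (count_mem (val z) (multigrafts (map val U) v))%:R
  | _ => 0
  end.
Proof.
rewrite star_mon raddf_sum /=; case: V => [|v V].
  rewrite -(mcoeff_mon k) -[in RHS](big_splits_nilr U (fun W => mon W)).
  rewrite raddf_sum [RHS]big_mkcond; apply: eq_bigr => p _.
  by rewrite mon_nil (tri_mon1 trip); case: eqP; rewrite ?mulr1 ?mulr0 ?mcoeff0.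
have E p : p.1 != [::] ->
    (mon p.1 * tri (mon p.2) (mon (v :: V)))@_(FMonom [:: z]) = 0.
  case: p => -[//|a p] q _.
  have := homogM (@homog_mon (a :: p)) (@homog_tri_mon q (v :: V)).
  move/(_ (FMonom [:: z])).
  by rewrite /= addnS; apply.
rewrite (bigID (fun p => p.1 == [::])) /= [X in _ + X]big1 ?addr0; last first.
  by move=> p; exact: E.
rewrite (eq_bigr (fun p => (tri (mon p.2) (mon (v :: V)))@_(FMonom [:: z]))).
  rewrite (big_splits_nil U
    (fun W => (tri (mon W) (mon (v :: V)))@_(FMonom [:: z]))).
  case: V {E} => [|w V]; last first.
    by rewrite (@homog_tri_mon U [:: v, w & V]).
  rewrite mon_cons mon_nil mulr1 tri_mon_vgen raddf_sum /=.
  rewrite -sum1_count natr_sum [RHS]big_mkcond; apply: eq_bigr => t _.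
  by rewrite mcoeff_ugen /=; case: (t == val z).
by move=> p /eqP ->; rewrite mon_nil mul1r.
Qed.

Lemma mcoeff_coproduct (Delta : PLOT k A -> PLOT2 k A) z U V :
  is_PLOT_coproduct tri Delta ->
  (Delta (word k [:: z]))@_(FMonom U, FMonom V) =
  (star tri (mon U) (mon V))@_(FMonom [:: z]).
Proof.
move/(_ (word k [:: z]) (mon U) (mon V)).
by rewrite tensorUU pairingUr pairingUl.
Qed.

End StarCoefficients.

(** * Shuffle products *)

Section Shuffles.

Context (k : fieldType) (A : finType).

Lemma shuffle_nil (P : PLOT k A) : shuffle (word k [::]) P = P.
Proof.
rewrite /shuffle /lin_ext2 lin_extU [RHS]monalgE /lin_ext.
apply: eq_bigr => t _; rewrite big_seq1 /word fmK.
by apply/malgP => s; rewrite mcoeffZ !mcoeffU mulr_natr.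
Qed.

Lemma mcoeff_word (r s : seq (vmon A)) : (word k r)@_(FMonom s) = (r == s)%:R.
Proof. exact: mcoeffU. Qed.

Lemma mcoeff_tensor_word (P : PLOT k A) (r s t : seq (vmon A)) :
  (tensor P (word k r))@_(FMonom s, FMonom t) = P@_(FMonom s) * (r == t)%:R.
Proof. exact: mcoeff_tensorU. Qed.

Lemma mcoeff_shuffle (s U : seq (vmon A)) (P : PLOT k A) :
  (shuffle (word k s) P)@_(FMonom U) =
  \sum_(p <- splits U | p.1 == s) P@_(FMonom p.2).
Proof.
rewrite /shuffle /lin_ext2 lin_extU /lin_ext raddf_sum /=.
rewrite [RHS]big_mkcond /=.
transitivity (\sum_(t <- msupp P) \sum_(p <- splits U)
    P@_t * (p == (s, fmonom_val t))%:R).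
  apply: eq_bigr => t _; rewrite mcoeffZ raddf_sum /= -mulr_sumr; congr (_ * _).
  transitivity ((count_mem U (shuffles s t))%:R : k).
    rewrite -sum1_count natr_sum [RHS]big_mkcond; apply: eq_bigr => w _.
    by rewrite mcoeff_word /=; case: (w == U).
  rewrite count_shuffles -sum1_count natr_sum big_mkcond; apply: eq_bigr => p _.
  by rewrite /=; case: (_ == _).
rewrite exchange_big; apply: eq_bigr => p _ /=.
case: ifP => hp; last first.
  rewrite big1 // => t _; case: (eqVneq p) => [e|]; last by rewrite mulr0.
  by rewrite e eqxx in hp.
rewrite -[RHS]sum_mcoeff_delta; apply: eq_bigr => t _; congr (_ * _%:R).
case: p hp => p1 p2 /= /eqP ->; rewrite xpair_eqE eqxx /= eq_sym.
by congr nat_of_bool; apply/eqP/eqP => [<-|->] //; rewrite fmK.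
Qed.

End Shuffles.

(** * Blocks and children of positions *)

Section Positions.

Context (A : finType) (z : vmon A).
Implicit Types (i j l m s : nat).

Local Notation p := (size z).
Local Notation next := (fun j => (block_end z j).+1).

(** Defined on all natural numbers, with no default letter, so that positions
    can be handled as plain numbers. *)
Definition arity j : nat := nth 0%N (unzip2 z) j.
Definition kids j : seq nat := traject next j.+1 (arity j).
(** The start of block number s after position j: the child number s of x_j for
    s < arity j, and the position just after the block of x_j for
    s = arity j ([next_kid]). *)
Definition kid j s : nat := iter s next j.+1.

Lemma ltn_next j : (j < next j)%N.
Proof. by rewrite ltnS leq_addr. Qed.

Lemma drop_letter x0 j : (j < p)%N -> drop j z = nth x0 z j :: drop j.+1 z.
Proof. by move=> hj; rewrite (drop_nth x0). Qed.

Lemma arityE x0 j : (j < p)%N -> arity j = (nth x0 z j).2.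
Proof. by move=> hj; rewrite /arity (nth_map x0). Qed.

Lemma suffix_forest j : (j <= p)%N -> exists m, forest m (drop j z).
Proof.
elim: j => [|j IH] hj; first by exists 1%N; rewrite drop0; exact: vmon_forest.
have [m] := IH (ltnW hj).
have [x0 _] := vmon_letter z.
rewrite (drop_letter x0 hj) /= => /andP[_ h]; eexists; exact: h.
Qed.

Lemma suffix_forestS j : (j < p)%N -> exists m, forest m.+1 (drop j z).
Proof.
move=> hj; have [[|m] hm] := suffix_forest (ltnW hj); last by exists m.
have := forest_gt0 hm; rewrite size_drop subn_gt0 hj //.
Qed.

Lemma blockP m j : (j < p)%N -> forest m.+1 (drop j z) ->
  [/\ (next j <= p)%N, in_V (block_word z j), forest m (drop (next j) z)
    & drop j z = block_word z j ++ drop (next j) z].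
Proof.
move=> hj /find_block; rewrite size_drop.
set s := find _ _ => -[hs hb ht].
have en : block_end z j = (j + s)%N by [].
have eb : block_word z j = take s.+1 (drop j z).
  by rewrite /block_word en take_drop addSn addnC.
have ed : drop (next j) z = drop s.+1 (drop j z).
  by rewrite en drop_drop addSn addnC.
rewrite eb ed cat_take_drop in_VE; split=> //; rewrite en; lia.
Qed.

Lemma block_in_V j : (j < p)%N -> in_V (block_word z j).
Proof. by move=> hj; have [m /(blockP hj)[]] := suffix_forestS hj. Qed.

Lemma blocksP m i s : (i <= p)%N -> forest (s + m) (drop i z) ->
  [/\ (iter s next i <= p)%N, forest m (drop (iter s next i) z),
      all (fun l => l < p)%N (traject next i s)
    & drop i z = flatten [seq block_word z l | l <- traject next i s]
                   ++ drop (iter s next i) z].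
Proof.
elim: s i => [|s IH] i hi h; first by [].
have hip : (i < p)%N.
  by rewrite ltn_neqAle hi andbT; apply/eqP => e; rewrite e drop_size in h.
have [h1 h2 h3 h4] := blockP hip h.
have [h5 h6 h7 h8] := IH _ h1 h3.
by rewrite iterSr; split=> //; rewrite /= ?hip // h4 h8 catA.
Qed.

Lemma kidsP m j s : (j < p)%N -> forest m.+1 (drop j z) -> (s <= arity j)%N ->
  [/\ (kid j s <= p)%N, forest (m + arity j - s) (drop (kid j s) z),
      all (fun l => l < p)%N (traject next j.+1 s)
    & drop j.+1 z = flatten [seq block_word z l | l <- traject next j.+1 s]
                   ++ drop (kid j s) z].
Proof.
move=> hj hm hs; apply: blocksP => //.
have [x0 _] := vmon_letter z.
move: hm; rewrite (drop_letter x0 hj) /= -arityE //.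
by rewrite subnKC // (leq_trans hs) ?leq_addl.
Qed.

Lemma kid_le j s : (j < p)%N -> (s <= arity j)%N -> (kid j s <= p)%N.
Proof. by move=> hj hs; have [m /kidsP/(_ hs)[]] := suffix_forestS hj. Qed.

Lemma kidS j s : kid j s.+1 = next (kid j s).
Proof. by []. Qed.

Lemma leq_kid j s s' : (s <= s')%N -> (kid j s <= kid j s')%N.
Proof.
move=> /subnKC <-; elim: (s' - s)%N => [|d IH]; first by rewrite addn0.
by rewrite addnS kidS (leq_trans IH) // ltnW // ltn_next.
Qed.

Lemma ltn_kid j s : (j < kid j s)%N.
Proof. exact: (@leq_kid j 0). Qed.

Lemma kid_lt j s : (j < p)%N -> (s < arity j)%N -> (kid j s < p)%N.
Proof. by move=> hj hs; rewrite (leq_trans (ltn_next _)) // -kidS kid_le. Qed.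

(** A tree is its root followed by the subtrees of its children; both sides of
    the equality are where the first tree of the suffix at j ends. *)
Lemma next_kid j : (j < p)%N -> next j = kid j (arity j).
Proof.
move=> hj; have [m hm] := suffix_forestS hj.
have [h1 h2 _ h4] := blockP hj hm.
have [h5 h6 h7 h8] := kidsP hj hm (leqnn _).
have [x0 _] := vmon_letter z.
rewrite (drop_letter x0 hj) h8 -cat_cons in h4.
rewrite in_VE in h2.
have [] := forest_cat_inj _ h2 h4.
  rewrite /= -(arityE x0 hj) add0n -[X in forest X](size_traject next j.+1).
  rewrite -(size_map (block_word z)); apply: forest_flatten; rewrite all_map.
  by apply: sub_all h7 => l /= /block_in_V; rewrite in_VE.
move=> _ /(congr1 size); rewrite !size_drop.
by move: h1 h5; move: (next j) (kid j _) => a b; lia.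
Qed.

Lemma mem_kids j i :
  reflect (exists2 s, (s < arity j)%N & i = kid j s) (i \in kids j).
Proof. exact: trajectP. Qed.

Lemma between_kids j m i : (j < i)%N -> (i < kid j m)%N ->
  exists s, [/\ (s < m)%N, (kid j s <= i)%N & (i < next (kid j s))%N].
Proof.
elim: m => [|m IH] hji him; first by move: hji him; rewrite /kid /=; lia.
have [/(IH hji) [s [h1 h2 h3]]|h] := ltnP i (kid j m).
  by exists s; split=> //; rewrite ltnW.
by exists m.
Qed.

(** Blocks are laminar: a position inside a block lies in the block of one of
    the children, and so on down to the position itself. *)
Lemma next_nested j i : (j < p)%N -> (j <= i)%N -> (i < next j)%N ->
  (next i <= next j)%N.
Proof.
have [n] := ubnP (i - j); elim: n j => // n IH j hn hj hji hi.
have [->//|ne] := eqVneq i j.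
have hji' : (j < i)%N by lia.
rewrite next_kid // in hi *.
have [s [h1 h2 h3]] := between_kids hji' hi.
have h4 := ltn_kid j s.
apply: leq_trans (IH _ _ _ h2 h3) _.
- lia.
- exact: kid_lt.
exact: (leq_kid j h1).
Qed.

Lemma kid_in_block j i : (j < p)%N -> i \in kids j -> (j < i < next j)%N.
Proof.
move=> hj /mem_kids[s hs ->]; rewrite ltn_kid next_kid //=.
by apply: leq_trans (leq_kid j hs); exact: ltn_next.
Qed.

(** If l is the larger of two parents of i, then l lies in the block of a child
    of j before i, and this block also contains the children of l. *)
Lemma parent_uniq j l i : (j < p)%N -> (l < p)%N ->
  i \in kids j -> i \in kids l -> j = l.
Proof.
wlog lt_jl : j l / (j < l)%N.
  move=> H hj hl ij il; have [h|h|//] := ltngtP j l; first exact: H.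
  by apply: esym; exact: H.
move=> hj hl /mem_kids[s hs ei] il.
have /andP[li inx] := kid_in_block hl il.
have lk : (l < kid j s)%N by rewrite -ei.
have [s' [h1 h2 h3]] := between_kids lt_jl lk.
have := next_nested (kid_lt hj (ltn_trans h1 hs)) h2 h3.
have := leq_kid j h1; rewrite kidS -ei => h4 h5.
by move: (leq_trans inx (leq_trans h5 h4)); rewrite ltnn.
Qed.

Lemma has_parent j i : (j < p)%N -> (j < i)%N -> (i < next j)%N ->
  exists l, [/\ (j <= l)%N, (l < p)%N & i \in kids l].
Proof.
have [n] := ubnP (i - j); elim: n j => // n IH j hn hj hji hi.
have hi' := hi; rewrite next_kid // in hi'.
have [s [h1 h2 h3]] := between_kids hji hi'.
have [e|ne] := eqVneq i (kid j s).
  by exists j; split=> //; apply/mem_kids; exists s.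
have h4 := ltn_kid j s.
have kp : (kid j s < p)%N by exact: kid_lt.
have [|//||//|l [l1 l2 l3]] := IH (kid j s); try lia.
by exists l; split=> //; lia.
Qed.

Lemma next0 : next 0 = p.
Proof.
have hz : (0 < p)%N by rewrite (forest_gt0 (vmon_forest z)).
have h1 : forest 1 (drop 0 z) by rewrite drop0 vmon_forest.
have [h2 _ h3 _] := blockP hz h1.
by apply/eqP; rewrite eqn_leq h2 -subn_eq0 -size_drop; case: (drop _ _) h3.
Qed.

Lemma has_parent_gt0 i : (0 < i)%N -> (i < p)%N ->
  exists2 l, (l < p)%N & i \in kids l.
Proof.
move=> h1 h2; have [|||l [_ l2 l3]] := @has_parent 0 i; rewrite ?next0 //.
  by apply: ltn_trans h2.
by exists l.
Qed.

Lemma kids_uniq j : uniq (kids j).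
Proof.
rewrite /kids; apply/(uniqP j.+1) => s s'; rewrite !inE !size_traject => hs hs'.
rewrite !nth_traject // -!/(kid _ _) => e.
have H a b : (a < b)%N -> (kid j a < kid j b)%N.
  by move=> hab; apply: leq_trans (leq_kid j hab); exact: ltn_next.
case: (ltngtP s s') => // /H; rewrite e ltnn //.
Qed.

End Positions.

(** * Cuts of the suffixes of a monomial *)

Section PartialCuts.

Context (A : finType) (z : vmon A).

Local Notation p := (size z).
Local Notation next := (fun j => (block_end z j).+1).
Implicit Types (i j l m s : nat) (c : {set 'I_p}).

(** Membership in a cut for a natural number, as in the filter that defines
    [cut_children]. *)
Definition cutpos c i : bool := i \in [seq val o | o in c].

Definition cut_kids c l : seq nat := [seq i <- kids z l | cutpos c i].

(** The cuts of the forest coded by the suffix of z at position j: only children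
    of positions at least j may be cut, which excludes the roots of this
    forest. For j = 0 these are the non-total left-admissible cuts of z. *)
Definition partial_cut j c : bool :=
  [&& [forall i in c, exists l : 'I_p, (j <= l)%N && (val i \in kids z l)],
      [forall l : 'I_p, cut_kids c l == take (size (cut_kids c l)) (kids z l)]
    & [forall i in c, forall l in c, (i != l) ==> ~~ in_block_tail z i l]].

Lemma cutposE c i : cutpos c i = oapp (mem c) false (insub i).
Proof.
case: insubP => [o _ <-|hi] /=.
  exact: (mem_image val_inj).
by apply/negbTE; apply/negP => /imageP[o _ e]; rewrite e ltn_ord in hi.
Qed.

Lemma cutpos_ord c (o : 'I_p) : cutpos c o = (o \in c).
Proof. by rewrite cutposE valK. Qed.

Lemma cutpos_lt c i : cutpos c i -> (i < p)%N.
Proof. by case/imageP => o _ ->; exact: ltn_ord. Qed.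

Lemma cutpos_set0 i : cutpos set0 i = false.
Proof. by apply/negbTE/negP => /imageP[o]; rewrite inE. Qed.

Lemma cutposU c d i : cutpos (c :|: d) i = cutpos c i || cutpos d i.
Proof. by rewrite !cutposE; case: insub => //= o; rewrite !inE. Qed.

Lemma cutposD c d i : cutpos (c :\: d) i = cutpos c i && ~~ cutpos d i.
Proof. by rewrite !cutposE; case: insub => //= o; rewrite !inE andbC. Qed.

Lemma cutpos_inj c d : cutpos c =1 cutpos d -> c = d.
Proof. by move=> e; apply/setP => o; rewrite -!cutpos_ord e. Qed.

Record partial_cut_spec j c : Prop := PartialCutSpec {
  cut_parent : forall i, cutpos c i ->
    exists l, [/\ (j <= l)%N, (l < p)%N & i \in kids z l];
  cut_initial : forall l, (l < p)%N ->
    cut_kids c l = take (size (cut_kids c l)) (kids z l);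
  cut_antichain : forall i l, cutpos c i -> cutpos c l -> (l < i)%N ->
    (next l <= i)%N }.

Lemma antichainP c :
  reflect (forall i l, cutpos c i -> cutpos c l -> (l < i)%N -> (next l <= i)%N)
    [forall i in c, forall l in c, (i != l) ==> ~~ in_block_tail z i l].
Proof.
apply: (iffP forall_inP) => [H i l hi hl li|H i hi].
  have ip := cutpos_lt hi; have lp := cutpos_lt hl.
  rewrite -[i]/(val (Ordinal ip)) cutpos_ord in hi.
  rewrite -[l]/(val (Ordinal lp)) cutpos_ord in hl.
  have := forall_inP (H _ hi) _ hl.
  by rewrite -val_eqE /= (gtn_eqF li) /in_block_tail li /= -ltnNge.
apply/forall_inP => l hl; apply/implyP => _.
rewrite /in_block_tail; apply/negP => /andP[li il].
have := H i l; rewrite !cutpos_ord hi hl => /(_ isT isT li).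
by rewrite ltnNge il.
Qed.

Lemma partial_cutP j c : reflect (partial_cut_spec j c) (partial_cut j c).
Proof.
apply: (iffP and3P) => [[/forall_inP h1 /forallP h2 /antichainP h3]|[h1 h2 h3]].
  split=> // [i hi|l hl].
    have ip := cutpos_lt hi; rewrite -[i]/(val (Ordinal ip)) cutpos_ord in hi.
    have /existsP[l /andP[jl il]] := h1 _ hi.
    by exists l.
  exact/eqP/(h2 (Ordinal hl)).
split; last exact/antichainP.
  apply/forall_inP => i hi.
  have [|l [jl lp il]] := h1 i; first by rewrite cutpos_ord.
  by apply/existsP; exists (Ordinal lp); rewrite jl.
by apply/forallP => l; apply/eqP/h2.
Qed.

Definition first_kids j m : {set 'I_p} :=
  [set o : 'I_p | val o \in traject next j.+1 m].

Lemma kids_take j m : (m <= arity z j)%N ->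
  take m (kids z j) = traject next j.+1 m.
Proof. by move=> hm; rewrite take_traject. Qed.

Lemma cutpos_first_kids j m i : (j < p)%N -> (m <= arity z j)%N ->
  cutpos (first_kids j m) i = (i \in traject next j.+1 m).
Proof.
move=> hj hm; rewrite cutposE; case: insubP => [o _ <-|hi] /=.
  by rewrite inE.
apply/esym/negbTE/negP => /trajectP[s hs e].
by move: hi; rewrite e -[iter _ _ _]/(kid z j s) kid_lt // (leq_trans hs).
Qed.

Lemma first_kidsP j m i : (j < p)%N -> (m <= arity z j)%N ->
  reflect (exists2 s, (s < m)%N & i = kid z j s) (cutpos (first_kids j m) i).
Proof. by move=> hj hm; rewrite cutpos_first_kids //; exact: trajectP. Qed.

Lemma first_kids_in j m i : (j < p)%N -> (m <= arity z j)%N ->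
  cutpos (first_kids j m) i -> i \in kids z j.
Proof.
move=> hj hm; rewrite cutpos_first_kids // -kids_take //; exact: mem_take.
Qed.

Lemma size_cut_kids c j : (size (cut_kids c j) <= arity z j)%N.
Proof. by rewrite size_filter (leq_trans (count_size _ _)) // size_traject. Qed.

Lemma partial_cut_gt j c i : partial_cut_spec j c -> cutpos c i -> (j < i)%N.
Proof.
move=> hc /(cut_parent hc)[l [jl lp /(kid_in_block lp)/andP[li _]]].
exact: leq_ltn_trans li.
Qed.

(** A cut of the suffix at j consists of the first m children of x_j and of a
    cut of the suffix that starts after their blocks. *)
Section Decompose.

Variables (j : nat) (c : {set 'I_p}).
Hypotheses (hj : (j < p)%N) (hc : partial_cut_spec j c).

Let m := size (cut_kids c j).
Let d := c :\: first_kids j m.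

Let hm : (m <= arity z j)%N. Proof. exact: size_cut_kids. Qed.

Let cut_kids_j : cut_kids c j = traject next j.+1 m.
Proof. by rewrite (cut_initial hc hj) kids_take. Qed.

Lemma first_kids_sub i : cutpos (first_kids j m) i -> cutpos c i.
Proof.
rewrite cutpos_first_kids // -cut_kids_j mem_filter; by case/andP.
Qed.

Lemma first_kids_setUD : first_kids j m :|: d = c.
Proof.
apply: cutpos_inj => i; rewrite cutposU cutposD.
by case h: (cutpos (first_kids j m) i); rewrite ?(first_kids_sub h) // andbT.
Qed.

(** A parent l of an element of the rest cannot be inside one of the first m
    blocks: its children would be inside too, below an element of the cut. *)
Lemma partial_cut_rest : partial_cut_spec (kid z j m) d.
Proof.
split=> [i|l hl|i l].
- rewrite cutposD => /andP[ci ni].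
  have [l [jl lp il]] := cut_parent hc ci; exists l; split=> //.
  have lt_jl : (j < l)%N.
    rewrite ltn_neqAle jl andbT; apply/eqP => e; move: ni.
    by rewrite cutpos_first_kids // -cut_kids_j mem_filter ci e il.
  rewrite leqNgt; apply/negP => lm.
  have [s [h1 h2 h3]] := between_kids lt_jl lm.
  have ks : cutpos c (kid z j s).
    by apply: first_kids_sub; apply/first_kidsP => //; exists s.
  have kp : (kid z j s < p)%N by exact: cutpos_lt ks.
  have /andP[li inl] := kid_in_block lp il.
  have := cut_antichain hc ci ks (leq_ltn_trans h2 li).
  by have := leq_trans inl (next_nested kp h2 h3); rewrite ltnNge => /negP.
- have [->|ne] := eqVneq l j.
    rewrite (_ : cut_kids d j = [::]) ?take0 //.
    apply: filter_nil => i ij.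
    rewrite cutposD cutpos_first_kids // -cut_kids_j mem_filter ij andbT.
    by case: (cutpos c i).
  suff -> : cut_kids d l = cut_kids c l by exact: cut_initial hc _ hl.
  apply: eq_in_filter => i il; rewrite cutposD.
  have -> : cutpos (first_kids j m) i = false; last by rewrite andbT.
  apply/negbTE/negP => /(first_kids_in hj hm) ij.
  by rewrite (parent_uniq hj hl ij il) eqxx in ne.
rewrite !cutposD => /andP[ci _] /andP[cl _]; exact: cut_antichain hc _ _ ci cl.
Qed.

End Decompose.

(** Conversely, any such pair is a cut of the suffix at j. *)
Section Compose.

Variables (j m : nat) (d : {set 'I_p}).
Hypotheses (hj : (j < p)%N) (hm : (m <= arity z j)%N).
Hypothesis (hd : partial_cut_spec (kid z j m) d).

Let c := first_kids j m :|: d.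

Lemma rest_no_kid i : cutpos d i -> i \notin kids z j.
Proof.
move=> /(cut_parent hd)[l [jl lp il]]; apply/negP => ij.
by move: jl; rewrite -(parent_uniq hj lp ij il) leqNgt ltn_kid.
Qed.

Lemma cut_kids_first : cut_kids c j = traject next j.+1 m.
Proof.
rewrite -kids_take //.
rewrite -[RHS](@filter_predT _ (take m (kids z j))).
rewrite /cut_kids -{1}(cat_take_drop m (kids z j)) filter_cat.
rewrite [X in _ ++ X](_ : _ = [::]) ?cats0.
  apply: eq_in_filter => i im.
  by rewrite cutposU cutpos_first_kids // -kids_take // im.
apply: filter_nil => i im.
rewrite cutposU cutpos_first_kids // -kids_take // negb_or; apply/andP; split.
  have := kids_uniq z j; rewrite -{1}(cat_take_drop m (kids z j)) cat_uniq.
  by case/and3P=> _ /hasPn/(_ i im).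
apply/negP => /rest_no_kid; by rewrite (mem_drop im).
Qed.

Lemma cut_kids_rest l : (l < p)%N -> l != j -> cut_kids c l = cut_kids d l.
Proof.
move=> hl ne; apply: eq_in_filter => i il; rewrite cutposU.
have -> : cutpos (first_kids j m) i = false; last by [].
apply/negbTE/negP => /(first_kids_in hj hm) ij.
by rewrite (parent_uniq hj hl ij il) eqxx in ne.
Qed.

Lemma partial_cut_cons : partial_cut_spec j c.
Proof.
have gt_d i : cutpos d i -> (kid z j m < i)%N by exact: partial_cut_gt.
split=> [i|l hl|i l].
- rewrite cutposU => /orP[/(first_kids_in hj hm) ij|]; first by exists j.
  move=> /(cut_parent hd)[l [jl lp il]]; exists l; split=> //.
  by rewrite (leq_trans _ jl) // ltnW // ltn_kid.
- have [->|ne] := eqVneq l j; last first.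
    by rewrite cut_kids_rest // {1}(cut_initial hd hl).
  by rewrite cut_kids_first size_traject kids_take.
rewrite !cutposU => /orP[/(first_kidsP _ hj hm)[s hs ->]|di];
    move=> /orP[/(first_kidsP _ hj hm)[s' hs' ->]|dl] li.
- rewrite -kidS leq_kid // ltnNge; apply/negP => /(leq_kid z j).
  by rewrite leqNgt li.
- have := ltn_trans (gt_d _ dl) li; rewrite ltnNge leq_kid // ltnW //.
- rewrite -kidS (leq_trans (leq_kid z j hs')) // ltnW //; exact: gt_d.
exact: cut_antichain hd _ _ di dl li.
Qed.

Lemma setUD_first_kids : c :\: first_kids j m = d.
Proof.
apply: cutpos_inj => i; rewrite cutposD cutposU.
case h: (cutpos (first_kids j m) i) => /=; last by rewrite andbT.
apply/esym/negbTE/negP => /rest_no_kid.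
by rewrite (first_kids_in hj hm h).
Qed.

End Compose.

Lemma partial_cut_total c : partial_cut p c = (c == set0).
Proof.
apply/partial_cutP/eqP => [hc|->].
  apply: cutpos_inj => i; rewrite cutpos_set0; apply/negbTE/negP.
  by move=> /(cut_parent hc)[l [pl lp _]]; rewrite ltnNge pl in lp.
have e i : cutpos set0 i = false by exact: cutpos_set0.
split=> [i|l _|i l]; rewrite ?e //.
by rewrite /cut_kids (eq_filter e) filter_pred0 take0.
Qed.

(** The bijection between the cuts of a suffix and pairs formed by a number m of
    first children and a cut of a shorter suffix. *)
Lemma big_partial_cut (M : nmodType) j (F : {set 'I_p} -> M) : (j < p)%N ->
  \sum_(c | partial_cut j c) F c =
  \sum_(m < (arity z j).+1) \sum_(d | partial_cut (kid z j m) d)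
     F (first_kids j m :|: d).
Proof.
move=> hj.
rewrite (partition_big
  (fun c => inord (size (cut_kids c j)) : 'I_(arity z j).+1) xpredT) //=.
apply: eq_bigr => m _; have hm : (m <= arity z j)%N by rewrite -ltnS.
rewrite (reindex_onto (fun d => first_kids j m :|: d)
                      (fun c => c :\: first_kids j m)) /=; last first.
  move=> c /andP[/partial_cutP hc /eqP e].
  have em : m = size (cut_kids c j) :> nat.
    by rewrite -e inordK // ltnS size_cut_kids.
  by rewrite em; exact: first_kids_setUD.
apply: eq_bigl => d; apply/andP/partial_cutP.
  case=> /andP[/partial_cutP hc /eqP e] /eqP ed.
  have em : m = size (cut_kids (first_kids j m :|: d) j) :> nat.
    by have := congr1 val e; rewrite /= inordK ?ltnS ?size_cut_kids.
  by have := partial_cut_rest hj hc; rewrite -em ed.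
move=> hd; rewrite setUD_first_kids // eqxx; split=> //.
apply/andP; split; first by apply/partial_cutP; exact: partial_cut_cons.
apply/eqP/val_inj; rewrite cut_kids_first // size_traject /= inordK //.
Qed.

End PartialCuts.

(** * Counting graftings by cuts *)

Section CutSums.

Context (k : fieldType) (A : finType) (z : vmon A) (x0 : letter A).

Local Notation p := (size z).
Local Notation next := (fun j => (block_end z j).+1).
Implicit Types (i j l m s : nat) (c d : {set 'I_p}) (U : seq (vmon A)).

Definition cut_away c l : bool := [exists i in c, in_block z l i].

Definition trunk_from j c : seq (letter A) :=
  [seq lower (size (cut_kids c l)) (nth x0 z l)
     | l <- iota j (p - j) & ~~ cut_away c l].

Definition pruning_from j c : PLOT k A :=
  \big[@shuffle k A / word k [::]]_(l <- iota j (p - j))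
    word k (map (block z) (cut_kids c l)).

Lemma cut_awayP c l :
  reflect (exists2 i, cutpos c i & (i <= l < next i)%N) (cut_away c l).
Proof.
apply: (iffP exists_inP) => [[i ic il]|[i ic il]].
  by exists i; rewrite ?cutpos_ord.
have ip := cutpos_lt ic; exists (Ordinal ip) => //.
by rewrite -cutpos_ord.
Qed.

(** One step of the reading from left to right: the positions between x_j and
    the suffix at [kid z j m] lie in the pruned blocks, hence contribute neither
    to the trunk nor to the shuffle. *)
Section Cons.

Variables (j m : nat) (d : {set 'I_p}).
Hypotheses (hj : (j < p)%N) (hm : (m <= arity z j)%N).
Hypothesis (hd : partial_cut_spec (kid z j m) d).

Let c := first_kids z j m :|: d.
Let hc : partial_cut_spec j c. Proof. exact: partial_cut_cons. Qed.

Lemma iota_cons_kid : iota j (p - j) =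
  j :: iota j.+1 (kid z j m - j.+1) ++ iota (kid z j m) (p - kid z j m).
Proof.
have h1 := ltn_kid z j m; have h2 := kid_le hj hm.
rewrite -subnSK //=; congr (_ :: _).
have -> : (p - j.+1 = (kid z j m - j.+1) + (p - kid z j m))%N by lia.
by rewrite iotaD subnKC.
Qed.

Lemma between_cut_away l : l \in iota j.+1 (kid z j m - j.+1) -> cut_away c l.
Proof.
have h1 := ltn_kid z j m.
rewrite mem_iota subnKC // => /andP[jl lm].
have [s [hs h2 h3]] := between_kids jl lm.
apply/cut_awayP; exists (kid z j s); last by rewrite h2.
by rewrite cutposU; apply/orP; left; apply/first_kidsP => //; exists s.
Qed.

Lemma cut_kids_cut_away l : cut_away c l -> (l < p)%N -> cut_kids c l = [::].
Proof.
move=> /cut_awayP[i ic /andP[il li]] lp.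
apply: filter_nil => i' i'l.
have /andP[lt_li' i'n] := kid_in_block lp i'l.
apply/negP => i'c; have := cut_antichain hc i'c ic (leq_ltn_trans il lt_li').
have := next_nested (cutpos_lt ic) il li.
by move=> h; rewrite leqNgt (leq_trans i'n h).
Qed.

Lemma cut_away_rest l : (kid z j m <= l)%N -> cut_away c l = cut_away d l.
Proof.
move=> ml; apply/cut_awayP/cut_awayP => -[i ic il]; exists i => //; last first.
  by rewrite cutposU ic orbT.
move: ic; rewrite cutposU => /orP[|//] /(first_kidsP _ hj hm)[s hs e].
case/andP: il => _; rewrite e -kidS => li.
by have := leq_trans li (leq_trans (leq_kid z j hs) ml); rewrite ltnn.
Qed.

Lemma trunk_from_cons :
  trunk_from j c = lower m (nth x0 z j) :: trunk_from (kid z j m) d.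
Proof.
rewrite /trunk_from iota_cons_kid /=.
have -> : cut_away c j = false.
  apply/negbTE/negP => /cut_awayP[i ic /andP[ij _]].
  by have := partial_cut_gt hc ic; rewrite ltnNge ij.
rewrite /= cut_kids_first // size_traject; congr (_ :: _).
rewrite filter_cat [X in X ++ _](_ : _ = [::]) /=.
  rewrite (@eq_in_filter _ _ (fun l => ~~ cut_away d l)).
    apply/eq_in_map => l; rewrite mem_filter mem_iota => /andP[_ /andP[ml lp]].
    have h1 := ltn_kid z j m; have h2 := kid_le hj hm.
    rewrite subnKC // in lp.
    by rewrite cut_kids_rest //; apply/eqP; lia.
  by move=> l; rewrite mem_iota => /andP[ml _]; rewrite cut_away_rest.
apply: filter_nil => l lm.
by rewrite (between_cut_away lm).
Qed.

Lemma pruning_from_cons : pruning_from j c =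
  shuffle (word k (map (block z) (traject next j.+1 m)))
    (pruning_from (kid z j m) d).
Proof.
rewrite /pruning_from iota_cons_kid big_cons (cut_kids_first hj hm hd).
congr (shuffle _ _).
have h1 := ltn_kid z j m; have h2 := kid_le hj hm.
have skip (r t : seq nat) : {in r, forall l, cut_kids c l = [::]} ->
    \big[@shuffle k A / word k [::]]_(l <- r ++ t)
       word k (map (block z) (cut_kids c l)) =
    \big[@shuffle k A / word k [::]]_(l <- t)
       word k (map (block z) (cut_kids c l)).
  elim: r => [|l r IH] hr; first by [].
  rewrite cat_cons big_cons (hr l (mem_head _ _)) shuffle_nil; apply: IH.
  by move=> l' l'r; apply: hr; rewrite inE l'r orbT.
rewrite skip => [|l lm].
  apply: eq_big_seq => l; rewrite mem_iota subnKC // => /andP[ml lp].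
  by rewrite cut_kids_rest //; apply/eqP; lia.
apply: cut_kids_cut_away; first exact: between_cut_away.
by move: lm; rewrite mem_iota; lia.
Qed.

End Cons.

Lemma forest_trunk_from n j c : (j <= p)%N -> partial_cut_spec j c ->
  forest n (drop j z) -> forest n (trunk_from j c).
Proof.
have [N] := ubnP (p - j); elim: N n j c => // N IH n j c hN.
rewrite leq_eqVlt => /orP[/eqP e|hj].
  by rewrite /trunk_from e subnn drop_size.
move=> hc hn; have hm := size_cut_kids c j.
have hd := partial_cut_rest hj hc.
rewrite -(first_kids_setUD hj hc) (trunk_from_cons hj hm hd) /=.
have n0 : (0 < n)%N by rewrite -(forest_gt0 hn) size_drop subn_gt0.
rewrite n0 /=; move: hn; rewrite -[n]prednK // => hn.
have [h1 h2 _ _] := kidsP hj hn hm.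
rewrite /= -(arityE x0 hj) addnBA //; apply: IH => //.
by have := ltn_kid z j (size (cut_kids c j)); lia.
Qed.

Lemma val_block l : (l < p)%N -> val (block z l) = block_word z l.
Proof. by move=> lp; rewrite /block insubdK //; exact: block_in_V. Qed.

(** [lower] truncates, hence the bound on m. *)
Lemma lower_raise m (a x : letter A) :
  ((m <= x.2)%N && (lower m x == a)) = (raise m a == x).
Proof.
case: a x => [a1 a2] [b1 b2]; rewrite /lower /raise !xpair_eqE /=.
rewrite (eq_sym b1) andbCA; congr andb; lia.
Qed.

(** Both sides obey the same recursion on y. On the left, the words attached to
    the first letter of y determine m as their number; since V(A) is a prefix
    code, the equality with the suffix of z splits into the equality of these
    words with the first m blocks after x_j and the same problem for the rest of
    y and the suffix after those blocks. On the right, this is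
    [big_partial_cut]. *)
Lemma count_multigrafts j U (y : seq (letter A)) : (j <= p)%N ->
  (count_mem (drop j z) (multigrafts (map val U) y))%:R =
  \sum_(c | partial_cut j c && (trunk_from j c == y))
     (pruning_from j c)@_(FMonom U).
Proof.
elim: y j U => [|a y IH] j U; rewrite leq_eqVlt => /orP[/eqP->|hj].
- rewrite drop_size (big_pred1 set0); last first.
    by move=> c; rewrite partial_cut_total /trunk_from subnn /= eqxx andbT.
  by rewrite /pruning_from subnn big_nil mcoeffU; case: U.
- rewrite big_mkcondr big_partial_cut // big1 => [|m _].
    have dz : drop j z != [::] by rewrite -size_eq0 size_drop subn_eq0 -ltnNge.
    by case: U; case: (drop j z) dz.
  apply: big1 => d /partial_cutP hd.
  by rewrite (trunk_from_cons hj _ hd) // -ltnS.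
- rewrite drop_size (big_pred0); last first.
    by move=> c; rewrite /trunk_from subnn /= andbF.
  rewrite (_ : count_mem _ _ = 0%N) //.
  apply/eqP; rewrite -leqn0 leqNgt -has_count.
  by apply/hasPn => t /allpairsPdep[? [? [_ _ ->]]].
rewrite big_mkcondr big_partial_cut //=.
(* The common value: m children of x_j are cut, and q.1 is the list of words
   attached to the first letter of y. *)
transitivity (\sum_(m < (arity z j).+1) \sum_(q <- splits U)
   if (lower m (nth x0 z j) == a)
      && (q.1 == map (block z) (traject next j.+1 m))
   then (count_mem (drop (kid z j m) z) (multigrafts (map val q.2) y))%:R
   else 0 : k); last first.
  apply: eq_bigr => m _; have hm : (m <= arity z j)%N by rewrite -ltnS.
  have -> : \sum_(d | partial_cut (kid z j m) d)
     (if trunk_from j (first_kids z j m :|: d) == a :: y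
      then (pruning_from j (first_kids z j m :|: d))@_(FMonom U) else 0) =
     \sum_(d | partial_cut (kid z j m) d) \sum_(q <- splits U)
       if (lower m (nth x0 z j) == a)
         && (q.1 == map (block z) (traject next j.+1 m))
         && (trunk_from (kid z j m) d == y)
       then (pruning_from (kid z j m) d)@_(FMonom q.2) else 0.
    apply: eq_bigr => d /partial_cutP hd.
    rewrite (trunk_from_cons hj hm hd) (pruning_from_cons hj hm hd) eqseq_cons.
    rewrite mcoeff_shuffle.
    case: eqP => _ /=; last by rewrite big1.
    case: eqP => _ /=; last by rewrite big1 // => q _; rewrite andbF.
    by rewrite big_mkcond; apply: eq_bigr => q _; rewrite andbT.
  rewrite exchange_big; apply: eq_bigr => q _ /=.
  rewrite IH ?kid_le // big_mkcondr.
  by case: ifP => _ //=; rewrite big1.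
rewrite exchange_big /= splits_map -sum1_count natr_sum big_mkcond.
rewrite big_allpairs_dep big_map; apply: eq_bigr => q _ /=.
rewrite size_map; set m := size q.1.
rewrite (drop_letter x0 hj).
have [lem|ltm] := leqP m (arity z j); last first.
  rewrite !big1 // => [l _|t _].
    case: ifP => // /andP[_ /eqP e].
    by move: ltm; rewrite /m e size_map size_traject ltnNge -ltnS ltn_ord.
  rewrite eqseq_cons -lower_raise -(arityE x0 hj).
  by rewrite leqNgt ltm.
have hm : (m < (arity z j).+1)%N by [].
(* Only m = size q.1 contributes. *)
rewrite (bigD1 (Ordinal hm)) //= [X in _ + X]big1 ?addr0; last first.
  move=> l ne; case: ifP => // /andP[_ /eqP e].
  by move: ne; rewrite -val_eqE /= /m e size_map size_traject eqxx.
have [M hM] := suffix_forestS hj.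
have [h1 h2 /allP h3 h4] := kidsP hj hM lem.
set B := map (block z) (traject next j.+1 m).
have eB : [seq block_word z l | l <- traject next j.+1 m] = map val B.
  by rewrite -map_comp; apply/eq_in_map => l /h3 lp; apply/esym/val_block.
rewrite h4 eB; case: ifP => [/andP[el /eqP eq]|ne].
  rewrite -sum1_count natr_sum [RHS]big_mkcond; apply: eq_bigr => t _ /=.
  rewrite eqseq_cons -lower_raise -(arityE x0 hj) lem el eq.
  rewrite eqseq_cat // eqxx /=.
  by case: (_ == _).
rewrite big1 // => t _; rewrite eqseq_cons -lower_raise -(arityE x0 hj) lem /=.
case: ifP => // /andP[el /eqP e].
have sB : size q.1 = size B by rewrite size_map size_traject.
have [eq _] := flatten_vmon_inj sB e.
by rewrite el eq eqxx in ne.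
Qed.

End CutSums.

(** * Left-admissible cuts of the whole monomial *)

Section WholeWord.

Context (k : fieldType) (A : finType) (z : vmon A).
Implicit Types (c : {set 'I_(size z)}).

Lemma childrenE (j : 'I_(size z)) : children j = kids z j.
Proof.
have [x0 _] := vmon_letter z.
by rewrite /children /kids (arityE x0) // (tnth_nth x0).
Qed.

Lemma cut_childrenE c (j : 'I_(size z)) : cut_children c j = cut_kids c j.
Proof. by rewrite /cut_children childrenE. Qed.

(** The root is the only position without a parent, so the condition 0 < i on
    the elements of a cut says that they have one. *)
Lemma nontotal_partial_cut c : nontotal_cut c = partial_cut 0 c.
Proof.
rewrite /nontotal_cut /partial_cut; congr [&& _, _ & _].
  apply/forall_inP/forall_inP => h i /h.
    move=> i0; have [l lp il] := has_parent_gt0 i0 (ltn_ord i).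
    by apply/existsP; exists (Ordinal lp).
  case/existsP => l /= il.
  by have /andP[li _] := kid_in_block (ltn_ord l) il; apply: leq_ltn_trans li.
apply: eq_forallb => j; rewrite cut_childrenE childrenE.
apply/existsP/eqP => [[m /eqP e]|e].
  by rewrite e size_takel // -ltnS; exact: ltn_ord.
have hm : (size (cut_kids c j) < (size (kids z j)).+1)%N.
  by rewrite ltnS size_filter count_size.
by exists (Ordinal hm); apply/eqP.
Qed.


Lemma trunk_wordE x0 c : trunk_word c = trunk_from x0 0 c.
Proof.
rewrite /trunk_word /trunk_from subn0 -val_enum_ord filter_map -map_comp.
by apply: eq_map => l /=; rewrite (tnth_nth x0) cut_childrenE.
Qed.

Lemma nontotal_neq_setT c : nontotal_cut c -> c != setT.
Proof.
case/and3P => /forall_inP h _ _; apply/eqP => e.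
have hz : (0 < size z)%N by rewrite (forest_gt0 (vmon_forest z)).
by have := h (Ordinal hz); rewrite e inE => /(_ isT).
Qed.

Lemma pruningE c : nontotal_cut c -> pruning k c = pruning_from k 0 c.
Proof.
move=> /nontotal_neq_setT /negbTE h.
rewrite /pruning h /pruning_from -[iota _ _]/(index_iota 0 (size z)).
by rewrite big_mkord; apply: eq_bigr => j _; rewrite cut_childrenE.
Qed.

Lemma remainderE c : nontotal_cut c -> remainder k c = word k [:: trunk c].
Proof. by move=> /nontotal_neq_setT /negbTE h; rewrite /remainder h. Qed.

(** The trunk is again the code of one tree, hence an element of V(A). *)
Lemma trunk_eq x0 c v : nontotal_cut c ->
  (trunk c == v) = (trunk_from x0 0 c == val v).
Proof.
move=> hc; rewrite -val_eqE /trunk insubdK ?(trunk_wordE x0) //.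
rewrite -[_ \in _]/(in_V _) in_VE; apply: forest_trunk_from => //.
  by apply/partial_cutP; rewrite -nontotal_partial_cut.
by rewrite drop0 vmon_forest.
Qed.

Lemma big_LAdm (M : nmodType) (F : {set 'I_(size z)} -> M) :
  \sum_(c in LAdm z) F c = F setT + \sum_(c | nontotal_cut c) F c.
Proof.
rewrite (bigD1 setT) /=; last by rewrite inE eqxx orbT.
congr (_ + _); apply: eq_bigl => c; rewrite inE.
have [->|ne] := eqVneq c setT; last by rewrite orbF andbT.
by rewrite andbF; apply/esym/negbTE/negP => /nontotal_neq_setT; rewrite eqxx.
Qed.

End WholeWord.

Theorem theorem3p8 (k : fieldType) (A : finType)
  (k_char0 : [pchar k] =i pred0)
  (tri : Ug k A -> Ug k A -> Ug k A)
  (tri_ext : postlie_extension tri)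
  (Delta_PLOT : PLOT k A -> PLOT2 k A)
  (Delta_PLOT_dual : is_PLOT_coproduct tri Delta_PLOT)
  (z : vmon A) :
  Delta_PLOT (word k [:: z]) =
    \sum_(c in LAdm z) tensor (pruning k c) (remainder k c).
Proof.
apply/malgP => -[[U] [V]].
rewrite (mcoeff_coproduct z U V Delta_PLOT_dual) (mcoeff_star_mon tri_ext).
rewrite big_LAdm mcoeffD [X in _ = _ + X]raddf_sum /=.
have -> : pruning k [set: 'I_(size z)] = word k [:: z] by rewrite /pruning eqxx.
have -> : remainder k [set: 'I_(size z)] = word k [::].
  by rewrite /remainder eqxx.
rewrite [X in _ = X + _]mcoeff_tensor_word mcoeff_word.
have [x0 _] := vmon_letter z.
transitivity (([:: z] == U)%:R * ([::] == V)%:R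
  + \sum_(c : {set 'I_(size z)} | partial_cut 0 c)
      (pruning_from k 0 c)@_(FMonom U)
        * (if V is [:: v] then trunk_from x0 0 c == val v else false)%:R : k).
  case: V => [|v [|v' V]]; last first.
  - by rewrite mulr0 add0r big1 // => c _; rewrite mulr0.
  - rewrite mulr0 add0r -{1}[val z]drop0 (count_multigrafts k x0) //.
    rewrite big_mkcondr; apply: eq_bigr => c _.
    by case: ifP => _; rewrite ?mulr1 ?mulr0.
  by rewrite mulr1 eq_sym big1 ?addr0 // => c _; rewrite mulr0.
congr (_ * _ + _) => //.
apply: eq_big => [c|c hc]; first by rewrite nontotal_partial_cut.
rewrite -nontotal_partial_cut in hc.
rewrite pruningE // remainderE // mcoeff_tensor_word.
by case: V => [|v [|v' V]]; rewrite ?eqseq_cons ?andbT ?andbF ?(trunk_eq x0).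
Qed.
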